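(* Let $K\subseteq\mathbb{R}^n$ be a compact set and let $X\subseteq K$ be a finite set. Then the following hold, where $d(X)$ is the uniqueness degree, $g(X)$ the generator degree and $i(X)$ the interpolation degree of $X$. 1. $d(X)\leq \max(2g(X),i(X))$. In particular, if $X$ has cardinality $k$ and is not contained in any (affine) hyperplane in $\mathbb{R}^n$, then $d(X)\leq 2(k-n+1)$. 2. If $X$ is contained in the interior $K^{\circ}$ of $K$, then $d(X)\geq \ell(X)$, where $\ell(X)$ is the smallest degree of a hypersurface which is singular at all points of $X$.
   Context: Let $V_{\leq d}$ be the vector space of real polynomials in $n$ variables of degree at most $d$. Let $\mathcal{S}(K)$ be the set of all (real-valued) signed Borel measures on $K$, and $\|\nu\|_{\rm TV}:=\sup\{\int_K g\,d\nu : g \text{ continuous on } K,\ \|g\|_\infty\leq 1\}$. A positive discrete measure supported on $X$ is a measure $\mu=\sum_{x\in X}c_x\delta_x$ with all $c_x\geq 0$. Uniqueness degree: $d(X)$ is the smallest integer $d$ such that for every positive discrete measure $\mu$ supported on $X$, the problem $$\min_{\nu\in\mathcal{S}(K)}\|\nu\|_{\rm TV}\quad\text{subject to}\quad \int_K f\,d\nu=\int_K f\,d\mu\ \text{ for all } f\in V_{\leq d}$$ has a unique solution. (This depends on $K$ as well as on $X$.) Interpolation degree: $i(X)$ is the minimum degree $d$ such that every real-valued function on $X$ is the restriction to $X$ of a polynomial of degree at most $d$. Generator degree: $g(X)$ is the maximum degree of a minimal generator of the ideal $I(X)$ of polynomials vanishing on $X$. Here degrees of minimal generators are computed after embedding $X$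 in the real projective space $\mathbb{P}^n$ via $(x_1,\dots,x_n)\mapsto[1:x_1:\dots:x_n]$ and taking $I(X)\subseteq\mathbb{R}[X_0,\dots,X_n]$ to be the ideal generated by all homogeneous polynomials vanishing at all points of the image of $X$; $g(X)$ is the maximum degree of an element of a minimal set of homogeneous generators of this ideal. A hypersurface of degree $\ell$ which is singular at all points of $X$ is given by a nonzero real polynomial $F$ of degree $\ell$ in $n$ variables (not necessarily irreducible or reduced) such that $F$ and all its first partial derivatives vanish at every point of $X$. *)

(* Defs.v *)
From HB Require Import structures.
From mathcomp Require Import all_boot all_order all_algebra.
From mathcomp Require Import all_classical all_reals all_analysis.
(* Only the structure instances of mpoly are imported: its notations clash with
   those of the analysis library. *)
From mathcomp Require mpoly.
Import (canonicals, coercions) mpoly.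

Set Implicit Arguments.
Unset Strict Implicit.
Unset Printing Implicit Defensive.

Import Order.TTheory GRing.Theory Num.Theory.
Import numFieldNormedType.Exports.

Local Open Scope classical_set_scope.
Local Open Scope ring_scope.

Notation "{ 'mpoly' R [ n ] }" := (mpoly.mpoly n R)
  (at level 0, R at level 2, n at level 2, format "{ 'mpoly'  R [ n ] }").

(* mpoly.mmeasure mpoly.mdeg p, written msize p in the multinomials library,
   is the total degree plus one, and 0 for p = 0. *)
Notation msize p := (mpoly.mmeasure mpoly.mdeg p).

Notation borel R n := (g_sigma_algebraType (@open 'rV[R]_n)).

Definition is_least (P : nat -> Prop) (m : nat) : Prop :=
  P m /\ forall k, P k -> (m <= k)%N.

Section Polynomials.
Context {R : realType} {n : nat}.
Implicit Types (p : {mpoly R[n]}) (x : 'rV[R]_n) (X : set 'rV[R]_n).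

Definition peval p x : R := mpoly.meval (x ord0) p.

Definition polys_deg_le (d : nat) : set {mpoly R[n]} :=
  [set p | (msize p <= d.+1)%N].

Definition is_interpolation_degree X : nat -> Prop := is_least (fun d =>
  forall h : 'rV[R]_n -> R, exists2 p, polys_deg_le d p &
    forall x, X x -> peval p x = h x).

Definition singular_along X p : Prop := forall x, X x ->
  peval p x = 0 /\ forall j : 'I_n, peval (mpoly.mderiv j p) x = 0.

Definition is_singular_degree X : nat -> Prop := is_least (fun l =>
  exists2 p, msize p = l.+1 & singular_along X p).

Definition hyperplane (H : set 'rV[R]_n) : Prop :=
  exists (a : 'cV[R]_n) (b : R), a != 0 /\ H = [set x | x *m a = b%:M].

End Polynomials.

Section GeneratorDegree.
Context {R : realType}.

Definition homogeneous m (F : {mpoly R[m]}) : Prop :=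
  exists d : nat, F \is mpoly.ishomog1 d mpoly.mdeg.

Definition ideal_gen m (S : set {mpoly R[m]}) : set {mpoly R[m]} :=
  [set F | exists2 s : seq ({mpoly R[m]} * {mpoly R[m]}),
    (forall q, q \in s -> S q.2) & F = \sum_(q <- s) q.1 * q.2].

Context {n : nat}.
Implicit Types (X : set 'rV[R]_n).

(* x |-> [1 : x_1 : ... : x_n]; vanishing of a homogeneous polynomial at a
   projective point does not depend on the representative. *)
Definition homog_coord (x : 'rV[R]_n) : 'rV[R]_(1 + n) := row_mx 1%:M x.

Definition vanishing_ideal X : set {mpoly R[1 + n]} :=
  ideal_gen [set F | homogeneous F /\
    forall x, X x -> peval F (homog_coord x) = 0].

Definition minimal_generators m (I G : set {mpoly R[m]}) : Prop :=
  [/\ forall F, G F -> homogeneous F, ideal_gen G = I &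
      forall H, H `<` G -> ideal_gen H <> I].

(* A minimal generating set is finite, the polynomial ring being Noetherian,
   and does not contain 0, so (msize F).-1 is the degree of F. *)
Definition is_generator_degree X (g : nat) : Prop :=
  exists2 G : seq {mpoly R[1 + n]},
    minimal_generators (vanishing_ideal X) [set` G] &
    g = (\max_(F <- G) (msize F).-1)%N.

End GeneratorDegree.

Section ChargeIntegral.
Context d (T : measurableType d) (R : realType).
Implicit Types (nu : {charge set T -> \bar R}) (D : set T) (f : T -> R).

Definition hahn_pos nu : set T := projT1 (cid (Hahn_decomposition nu)).
Definition hahn_neg nu : set T :=
  projT1 (cid (projT2 (cid (Hahn_decomposition nu)))).
Definition hahnP nu : hahn_decomposition nu (hahn_pos nu) (hahn_neg nu) :=
  projT2 (cid (projT2 (cid (Hahn_decomposition nu)))).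

(* The two measures, hence the integral, do not depend on the chosen Hahn
   decomposition. *)
Definition charge_integral nu D f : R :=
  \int[jordan_pos (hahnP nu)]_(x in D) f x
  - \int[jordan_neg (hahnP nu)]_(x in D) f x.

End ChargeIntegral.

Section UniquenessDegree.
Context {R : realType} {n : nat}.
Implicit Types (K X : set 'rV[R]_n) (mu : {measure set (borel R n) -> \bar R})
  (nu : {charge set (borel R n) -> \bar R}).

(* Signed Borel measures on K are encoded as signed Borel measures on R^n that
   vanish off K. Only values on measurable sets are meaningful. *)
Definition signed_measure_on K nu : Prop :=
  forall A : set (borel R n), measurable A -> nu A = nu (A `&` K).

Definition tv_norm K nu : \bar R :=
  ereal_sup [set (charge_integral nu K g)%:E | g in
    [set g : 'rV[R]_n -> R | {within K, continuous g} /\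
                             forall x, K x -> `|g x| <= 1]].

Definition positive_discrete X mu : Prop :=
  exists2 c : 'rV[R]_n -> R, (forall x, 0 <= c x) &
    forall A : set (borel R n), measurable A ->
      mu A = (\sum_(x \in X) (c x)%:E * \d_(x : borel R n) A)%E.

Definition feasible K (d : nat) mu nu : Prop :=
  signed_measure_on K nu /\
  forall p : {mpoly R[n]}, polys_deg_le d p ->
    charge_integral nu K (peval p) = \int[mu]_(x in K) peval p x.

Definition minimizer K (d : nat) mu nu : Prop :=
  feasible K d mu nu /\
  forall nu', feasible K d mu nu' -> (tv_norm K nu <= tv_norm K nu')%E.

Definition unique_solution K (d : nat) mu : Prop :=
  exists2 nu, minimizer K d mu nu &
    forall nu', minimizer K d mu nu' ->
      forall A : set (borel R n), measurable A -> nu' A = nu A.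

Definition is_uniqueness_degree K X : nat -> Prop := is_least (fun d =>
  forall mu, positive_discrete X mu -> unique_solution K d mu).

End UniquenessDegree.

(* Main.v *)
Require Import Defs.
From HB Require Import structures.
From mathcomp Require Import all_boot all_order all_algebra.
From mathcomp Require Import all_classical all_reals all_analysis.
From mathcomp Require mpoly.
From mathcomp Require Import measurable_realfun ring lra.
Import (canonicals, coercions) mpoly.

Set Implicit Arguments.
Unset Strict Implicit.
Unset Printing Implicit Defensive.

Import Order.TTheory GRing.Theory Num.Theory.
Import numFieldNormedType.Exports.

Local Open Scope classical_set_scope.
Local Open Scope ring_scope.

(** A positive measure mu on X has total variation int 1 dmu, which bounds from
    below the norm of every signed measure with the same moments. Hence every
    positive measure with the moments of mu is a minimizer, and conversely
    (Lusin) every minimizer is positive. If some f >= 0 of degree <= d vanishes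
    exactly on X, a minimizer nu has int f dnu = 0, so it lives on X, and
    interpolation in degree <= d determines its weights. Such an f is a sum of
    squares of generators of I(X) or, when X spans, a sum of terms
    L(y)^2 * prod_(z in X, L(z) != 0) |y - z|^2 with L affine and vanishing on
    at least n points of X.
    For the lower bound, if no nonzero polynomial of degree <= d is singular
    along X, the evaluations and derivatives at X span the dual of the
    polynomials of degree <= d. Replacing derivatives by difference quotients of
    small step yields a positive discrete measure on K that has an atom outside X
    and the same moments of degree <= d as a large multiple of
    sum_(x in X) delta_x. *)

(** * Polynomial functions *)

Section PolynomialFunctions.
Context {R : realType} {n : nat}.
Implicit Types (e : nat) (f g : 'rV[R]_n -> R) (x y : 'rV[R]_n).

(** Degree bounds are tracked on functions, so that sums of squares and products need no explicit
    coefficients; [e] is only an upper bound for the degree. *)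
Definition polyfun e f : Prop :=
  exists2 p : {mpoly R[n]}, polys_deg_le e p & peval p =1 f.

Lemma polyfunW e e' f : (e <= e')%N -> polyfun e f -> polyfun e' f.
Proof.
by move=> ee' [p pe pf]; exists p => //; apply: leq_trans pe _; rewrite ltnS.
Qed.

Lemma eq_polyfun e f g : f =1 g -> polyfun e f -> polyfun e g.
Proof. by move=> fg [p pe pf]; exists p => // x; rewrite pf fg. Qed.

Lemma polyfun_cst e (c : R) : polyfun e (fun=> c).
Proof.
exists (mpoly.mpolyC n c); last by move=> x; rewrite /peval mpoly.mevalC.
by rewrite /polys_deg_le /= mpoly.msizeC; case: eqP.
Qed.

Lemma polyfunD e f g :
  polyfun e f -> polyfun e g -> polyfun e (fun x => f x + g x).
Proof.
move=> [p pe pf] [q qe qg]; exists (p + q).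
  by apply: leq_trans (mpoly.msizeD_le _ _) _; rewrite geq_max pe qe.
by move=> x; rewrite /peval mpoly.mevalD -pf -qg.
Qed.

Lemma polyfunM e1 e2 f g :
  polyfun e1 f -> polyfun e2 g -> polyfun (e1 + e2) (fun x => f x * g x).
Proof.
move=> [p pe pf] [q qe qg]; exists (p * q); last first.
  by move=> x; rewrite /peval mpoly.mevalM -pf -qg.
rewrite /polys_deg_le /=; have [->|p0] := eqVneq p 0.
  by rewrite mul0r mpoly.mmeasure0.
have [->|q0] := eqVneq q 0; first by rewrite mulr0 mpoly.mmeasure0.
rewrite mpoly.msizeM// -subn1 leq_subLR; apply: leq_trans (leq_add pe qe) _.
by rewrite addSn addnS add1n.
Qed.

Lemma polyfun_coord j : polyfun 1 (fun x => x ord0 j).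
Proof.
exists (mpoly.mpolyX R (mpoly.mnm1 j)).
  by rewrite /polys_deg_le /= mpoly.msizeX mpoly.mdeg1.
by move=> x; rewrite /peval mpoly.mevalXU.
Qed.

Lemma polyfun_sum (I : Type) (r : seq I) (P : pred I) e (F : I -> 'rV[R]_n -> R) :
  (forall i, P i -> polyfun e (F i)) -> polyfun e (fun x => \sum_(i <- r | P i) F i x).
Proof.
move=> FP; elim: r => [|i r IH].
  by apply: eq_polyfun (polyfun_cst e 0) => x; rewrite big_nil.
have [Pi|nPi] := boolP (P i).
  by apply: eq_polyfun (polyfunD (FP i Pi) IH) => x; rewrite big_cons Pi.
by apply: eq_polyfun IH => x; rewrite big_cons (negbTE nPi).
Qed.

Lemma polyfun_prod (I : finType) (A : {set I}) e (F : I -> 'rV[R]_n -> R) :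
  (forall i, polyfun e (F i)) ->
  polyfun (e * #|A|) (fun x => \prod_(i in A) F i x).
Proof.
move=> FP; rewrite cardE mulnC.
apply: (@eq_polyfun _ (fun x => \prod_(i <- enum A) F i x)).
  by move=> x; rewrite big_enum.
elim: (enum A) => [|i r IH].
  by apply: eq_polyfun (polyfun_cst _ 1) => x; rewrite big_nil.
by apply: eq_polyfun (polyfunM (FP i) IH) => x; rewrite big_cons.
Qed.

Lemma polyfunX e k f : polyfun e f -> polyfun (k * e) (fun x => f x ^+ k).
Proof.
move=> fP; elim: k => [|k IH].
  by apply: eq_polyfun (polyfun_cst _ 1) => x; rewrite expr0.
by apply: eq_polyfun (polyfunM fP IH) => x; rewrite exprS.
Qed.

(** The Euclidean distance, since the norm carried by row vectors is the max norm, whose square is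
    not polynomial in general. *)
Definition sqdist (x y : 'rV[R]_n) : R := \sum_j (y ord0 j - x ord0 j) ^+ 2.

Lemma polyfun_sqdist x : polyfun 2 (sqdist x).
Proof.
apply: polyfun_sum => j _; apply: (@polyfunX 1 2 (fun y => y ord0 j - x ord0 j)).
by apply: polyfunD; [exact: polyfun_coord | exact: polyfun_cst].
Qed.

Lemma sqdist_ge0 x y : 0 <= sqdist x y.
Proof. by apply: sumr_ge0 => j _; exact: sqr_ge0. Qed.

Lemma sqdist_eq0 x y : (sqdist x y == 0) = (x == y).
Proof.
rewrite psumr_eq0; last by move=> j _; exact: sqr_ge0.
apply/allP/eqP => [h|-> j _]; last by rewrite /= subrr expr0n eqxx.
apply/rowP => j; have /= := h j (mem_index_enum _).
by rewrite expf_eq0 subr_eq0 => /eqP ->.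
Qed.

(** Substituting affine functions for the variables does not raise the degree. It serves to
    dehomogenize the generators of the ideal. *)
Lemma polyfun_comp m e (F : {mpoly R[m]}) (h : 'I_m -> 'rV[R]_n -> R) :
  polys_deg_le e F -> (forall i, polyfun 1 (h i)) ->
  polyfun e (fun y => mpoly.meval (h^~ y) F).
Proof.
move=> Fe hP.
apply: (@eq_polyfun _ (fun y => \sum_(s <- mpoly.msupp F | s \in mpoly.msupp F)
   mpoly.mcoeff s F * \prod_i h i y ^+ s i)).
  by move=> y; rewrite mpoly.mevalE -big_seq.
apply: polyfun_sum => s sF; rewrite -[e]add0n.
apply: polyfunM (polyfun_cst _ _) _.
apply: (@polyfunW (mpoly.mdeg s)).
  by rewrite -ltnS; apply: leq_trans Fe; exact: mpoly.msize_mdeg_lt.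
rewrite mpoly.mdegE.
elim: (index_enum _) => [|i r IH].
  rewrite big_nil; apply: eq_polyfun (polyfun_cst _ 1) => y; by rewrite big_nil.
rewrite big_cons; under [X in polyfun _ X]eq_fun do rewrite big_cons.
by apply: polyfunM IH; rewrite -{1}[s i]muln1; exact: (polyfunX (s i) (hP i)).
Qed.

End PolynomialFunctions.

(** * Nonnegative polynomials vanishing exactly on a finite set *)

Section DualCertificate.
Context {R : realType} {n k : nat}.
Variable (xs : 'I_k -> 'rV[R]_n).
Hypothesis xs_inj : injective xs.
Implicit Types (s A : {set 'I_k}) (y : 'rV[R]_n).

(** The first half confines a minimizer to the points, the second determines its weights there. *)
Definition certified (d : nat) : Prop :=
  (exists2 f, polyfun d f & (forall y, 0 <= f y) /\
     forall y, (f y == 0) = [exists i, y == xs i]) /\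
  forall h : 'I_k -> R, exists2 f, polyfun d f & forall i, f (xs i) = h i.

Lemma lagrange_interpolation d :
  (forall i, exists2 f, polyfun d f &
     f (xs i) != 0 /\ forall j, j != i -> f (xs j) = 0) ->
  forall h : 'I_k -> R, exists2 f, polyfun d f & forall i, f (xs i) = h i.
Proof.
move=> H h.
have /choice[f fP] : forall i, exists f, polyfun d f /\
    (f (xs i) != 0 /\ forall j, j != i -> f (xs j) = 0).
  by move=> i; have [f ? ?] := H i; exists f.
exists (fun y => \sum_i f i y * (h i / f i (xs i))).
  apply: polyfun_sum => i _; rewrite -[d]addn0.
  by apply: polyfunM; [exact: (fP i).1 | exact: polyfun_cst].
move=> i; rewrite (bigD1 i)//= big1 ?addr0.
  by rewrite mulrCA divff ?mulr1//; exact: (fP i).2.1.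
by move=> j ji; rewrite (fP j).2.2 ?mul0r// eq_sym.
Qed.

Definition sqdist_prod (A : {set 'I_k}) (y : 'rV[R]_n) : R :=
  \prod_(i in A) sqdist (xs i) y.

Lemma polyfun_sqdist_prod A : polyfun (2 * #|A|) (sqdist_prod A).
Proof. by apply: polyfun_prod => i; exact: polyfun_sqdist. Qed.

Lemma sqdist_prod_ge0 A y : 0 <= sqdist_prod A y.
Proof. by apply: prodr_ge0 => i _; exact: sqdist_ge0. Qed.

Lemma sqdist_prod_eq0 (A : {set 'I_k}) y :
  (sqdist_prod A y == 0) = [exists i in A, y == xs i].
Proof.
apply/prodf_eq0/exists_inP => -[i iA].
  by rewrite sqdist_eq0 eq_sym => ?; exists i.
by move=> yx; exists i => //; rewrite sqdist_eq0 eq_sym.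
Qed.

(** A crude degree, but available for every finite set: it guarantees that the uniqueness degree
    exists. *)
Lemma certified_sqdist : certified (2 * k).
Proof.
split.
  exists (sqdist_prod [set: 'I_k]).
    by rewrite -[k in (2 * k)%N]card_ord -cardsT; exact: polyfun_sqdist_prod.
  split=> y; first exact: sqdist_prod_ge0.
  rewrite sqdist_prod_eq0; apply/exists_inP/existsP => -[i]; last by exists i.
  by move=> _; exists i.
apply: lagrange_interpolation => i; exists (sqdist_prod (~: [set i])).
  apply: polyfunW (polyfun_sqdist_prod _).
  by rewrite leq_mul2l /= -[k in (_ <= k)%N]card_ord max_card.
split=> [|j ji].
  rewrite sqdist_prod_eq0; apply/negP => /exists_inP[j].
  by rewrite !inE => /negP ji /eqP/xs_inj ij; apply: ji; rewrite ij.
by apply/eqP; rewrite sqdist_prod_eq0; apply/exists_inP; exists j; rewrite ?inE.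
Qed.

(* The rows of [kermx (points_mx s)^T] span the affine functions, encoded by
   their coefficients, that vanish at all points of [s]. *)
Definition points_mx (s : {set 'I_k}) : 'M[R]_(#|s|, 1 + n) :=
  \matrix_(i < #|s|) homog_coord (xs (enum_val i)).

(** The sum of L(y)^2 over these rows L. Summing avoids choosing L: the value is nonzero as soon as
    one affine function vanishing on [s] is nonzero at [y]. *)
Definition sqnorm_ann (s : {set 'I_k}) (y : 'rV[R]_n) : R :=
  \sum_j ((kermx (points_mx s)^T *m (homog_coord y)^T) j ord0) ^+ 2.

Lemma polyfun_sqnorm_ann s : polyfun 2 (sqnorm_ann s).
Proof.
apply: polyfun_sum => j _.
apply: (@polyfunX _ _ 1 2 (fun y => (_ *m (homog_coord y)^T) j ord0)).
apply: (@eq_polyfun _ _ _ (fun y => \sum_i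
    kermx (points_mx s)^T j i * homog_coord y ord0 i)).
  move=> y; rewrite [RHS]mxE; apply: eq_bigr => i _.
  by rewrite [(homog_coord y)^T _ _]mxE.
apply: polyfun_sum => i _; apply: (@polyfunM _ _ 0 1); first exact: polyfun_cst.
case: (split_ordP i) => l ->.
  by apply: eq_polyfun (polyfun_cst _ 1) => y; rewrite row_mxEl mxE (ord1 l) eqxx.
by apply: eq_polyfun (polyfun_coord l) => y; rewrite row_mxEr.
Qed.

Lemma sqnorm_ann_ge0 s y : 0 <= sqnorm_ann s y.
Proof. by apply: sumr_ge0 => j _; exact: sqr_ge0. Qed.

Lemma sqnorm_ann_neq0P s y :
  reflect (exists2 u : 'rV_(1 + n), forall i, i \in s ->
             u *m (homog_coord (xs i))^T = 0 & u *m (homog_coord y)^T != 0)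
          (sqnorm_ann s y != 0).
Proof.
have E : (sqnorm_ann s y == 0) =
    (kermx (points_mx s)^T *m (homog_coord y)^T == 0).
  rewrite psumr_eq0; last by move=> j _; exact: sqr_ge0.
  apply/allP/eqP => [h|-> j _]; last by rewrite mxE expr0n eqxx.
  apply/matrixP => i j; rewrite ord1; have /= := h i (mem_index_enum _).
  by rewrite sqrf_eq0 => /eqP ->; rewrite mxE.
rewrite E.
have uP (u : 'rV_(1 + n)) : (u <= kermx (points_mx s)^T)%MS <->
    (forall i, i \in s -> u *m (homog_coord (xs i))^T = 0).
  split=> [/sub_kermxP us i si|us].
    have /rowP/(_ (enum_rank_in si i)) := us.
    rewrite !mxE => us0; apply/rowP => j; rewrite ord1 !mxE -[RHS]us0.
    by apply: eq_bigr => l _; rewrite !mxE enum_rankK_in.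
  apply/sub_kermxP/rowP => i; rewrite [RHS]mxE mxE.
  have /rowP/(_ ord0) := us _ (enum_valP i); rewrite mxE [X in _ = X]mxE => us0.
  by rewrite -[RHS]us0; apply: eq_bigr => l _; rewrite !mxE.
apply: (iffP idP) => [|[u /uP us]].
  move=> /matrix0Pn[j [l]]; rewrite ord1 => jl.
  exists (row j (kermx (points_mx s)^T)); first by apply/uP; exact: row_sub.
  by apply: contraNneq jl => /rowP/(_ ord0); rewrite -row_mul !mxE => ->.
apply: contraNneq => h; have /submxP[D ->] := us.
by rewrite -mulmxA h mulmx0.
Qed.

Lemma sqnorm_ann_mem s i : i \in s -> sqnorm_ann s (xs i) = 0.
Proof.
move=> si; apply/eqP; apply: contraT => /sqnorm_ann_neq0P[u us].
by rewrite us ?eqxx.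
Qed.

(* A maximal set s of points vanishing under an affine function L with L(y) != 0
   has at least n elements: otherwise some M != 0 vanishes on s and at y, but
   not at all points, and L - c M vanishes at one more point. *)
Lemma sqnorm_ann_large y : ~ (exists2 H, hyperplane H & range xs `<=` H) ->
  exists2 s : {set 'I_k}, sqnorm_ann s y != 0 & (n <= #|s|)%N.
Proof.
move=> nH.
(* For the empty set there is no vanishing condition, and the constant function 1 serves. *)
have P0 : sqnorm_ann finset.set0 y != 0.
  apply/sqnorm_ann_neq0P; exists (row_mx 1%:M 0); first by move=> i; rewrite inE.
  rewrite tr_row_mx mul_row_col mul0mx addr0 trmx1 mulmx1.
  by apply/eqP => /rowP/(_ ord0); rewrite !mxE => /eqP; rewrite oner_eq0.
have [s sy smax] := @arg_maxnP _ _ (fun s => sqnorm_ann s y != 0) (fun s => #|s|) P0.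
exists s => //; rewrite leqNgt; apply/negP => sn.
have /sqnorm_ann_neq0P[L Ls Ly] := sy.
pose A := row_mx (points_mx s)^T (homog_coord y)^T.
(* [A] has [1 + n] rows but only [#|s| + 1 <= n] columns. *)
have : kermx A != 0.
  rewrite -mxrank_eq0 mxrank_ker subn_eq0 -ltnNge.
  by apply: leq_ltn_trans (rank_leq_col A) _; rewrite addn1 add1n ltnS.
case/rowV0Pn => M /sub_kermxP; rewrite mul_mx_row => MA M0.
have [Ms My] : M *m (points_mx s)^T = 0 /\ M *m (homog_coord y)^T = 0.
  by move: MA; rewrite -[0]row_mx0 => /eq_row_mx.
have {}Ms i : i \in s -> M *m (homog_coord (xs i))^T = 0.
  move=> si; have /rowP/(_ (enum_rank_in si i)) := Ms.
  rewrite !mxE => us0; apply/rowP => j; rewrite ord1 !mxE -[RHS]us0.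
  by apply: eq_bigr => l _; rewrite !mxE enum_rankK_in.
have [i0 Mi0] : exists i, M *m (homog_coord (xs i))^T != 0.
  apply: contrapT => /forallNP h; apply: nH.
  have ME z : M *m (homog_coord z)^T = lsubmx M + z *m (rsubmx M)^T.
    rewrite -{1}[M]hsubmxK tr_row_mx mul_row_col trmx1 mulmx1.
    congr (_ + _); rewrite -[LHS]trmxK trmx_mul trmxK.
    by apply/rowP => j; rewrite !ord1 [LHS]mxE.
  exists [set x | x *m (rsubmx M)^T = (- M ord0 (lshift n ord0))%:M]; last first.
    move=> _ [i _ <-] /=; have /negP/negPn/eqP := h i; rewrite ME => /eqP.
    rewrite addrC addr_eq0 => /eqP ->; apply/rowP => j.
    by rewrite !ord1 !mxE eqxx.
  exists (rsubmx M)^T, (- M ord0 (lshift n ord0)); split => //.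
  (* Were the linear part of [M] zero, [M] would be constant, hence zero because it vanishes at
     [y]. *)
  apply: contraNneq M0 => /(congr1 trmx); rewrite trmxK trmx0 => M2.
  have := My; rewrite ME M2 trmx0 mulmx0 addr0 => M1.
  by rewrite -[M]hsubmxK M1 M2 row_mx0.
pose c := (L *m (homog_coord (xs i0))^T) ord0 ord0 /
          (M *m (homog_coord (xs i0))^T) ord0 ord0.
have i0s : i0 \notin s by apply: contraNN Mi0 => /Ms ->.
suff /smax : sqnorm_ann (i0 |: s) y != 0 by rewrite cardsU1 i0s add1n /= ltnn.
apply/sqnorm_ann_neq0P; exists (L - c *: M); last first.
  by rewrite mulmxBl -scalemxAl My scaler0 subr0.
move=> i; rewrite !inE => /orP[/eqP ->|si].
  rewrite mulmxBl -scalemxAl {}/c; move: (L *m _) (M *m _) Mi0 => a b b0.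
  apply/rowP => j; rewrite !ord1 !mxE divfK ?subrr//.
  by apply: contraNneq b0 => h; apply/eqP/rowP => l; rewrite !ord1 h mxE.
by rewrite mulmxBl -scalemxAl Ms// Ls// scaler0 subr0.
Qed.

(** A set [s] with at least [n] elements gives a term of degree at most 2 + 2(k - n). At each point
    either the affine factor or the product vanishes, and off the points [sqnorm_ann_large] provides
    a nonzero term. *)
Lemma certified_nondegenerate :
  ~ (exists2 H, hyperplane H & range xs `<=` H) -> certified (2 * (k - n + 1)).
Proof.
move=> nH; split.
  exists (fun y => \sum_(s : {set 'I_k} | (n <= #|s|)%N)
                     sqnorm_ann s y * sqdist_prod (~: s) y).
    apply: polyfun_sum => s ns.
    apply: polyfunW (polyfunM (polyfun_sqnorm_ann s) (polyfun_sqdist_prod _)).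
    by rewrite cardsCs finset.setCK card_ord mulnDr addnC leq_add2r leq_mul2l leq_sub2l.
  have ge0 s y : 0 <= sqnorm_ann s y * sqdist_prod (~: s) y.
    by rewrite mulr_ge0 ?sqnorm_ann_ge0 ?sqdist_prod_ge0.
  split=> y; first by apply: sumr_ge0 => s _.
  rewrite psumr_eq0//; apply/allP/existsP => [h|[i /eqP -> s _]].
    have [s sy ns] := sqnorm_ann_large y nH.
    have := h s (mem_index_enum _); rewrite ns mulf_eq0 (negbTE sy) /=.
    by rewrite sqdist_prod_eq0 => /exists_inP[i _ ?]; exists i.
  apply/implyP => _; rewrite mulf_eq0; have [si|si] := boolP (i \in s).
    by rewrite sqnorm_ann_mem ?eqxx.
  rewrite sqdist_prod_eq0; apply/orP; right.
  by apply/exists_inP; exists i; rewrite ?inE.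
apply: lagrange_interpolation => i.
have [s sy ns] := sqnorm_ann_large (xs i) nH.
(* Only the factor at [xs i] is dropped; points of [s] are killed by the affine factor, the others
   by their own factor. *)
exists (fun y => sqnorm_ann s y * sqdist_prod (~: s :\ i) y).
  apply: polyfunW (polyfunM (polyfun_sqnorm_ann s) (polyfun_sqdist_prod _)).
  rewrite mulnDr addnC leq_add2r leq_mul2l /=.
  apply: leq_trans (subset_leq_card (subD1set _ _)) _.
  by rewrite cardsCs finset.setCK card_ord leq_sub2l.
split=> [|j ji].
  rewrite mulf_neq0// sqdist_prod_eq0; apply/negP => /exists_inP[j].
  by rewrite !inE => /andP[/negP ji _] /eqP/xs_inj ij; apply: ji; rewrite ij.
apply/eqP; rewrite mulf_eq0; have [sj|sj] := boolP (j \in s).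
  by rewrite sqnorm_ann_mem ?eqxx.
rewrite sqdist_prod_eq0; apply/orP; right.
by apply/exists_inP; exists j; rewrite ?inE ?ji.
Qed.

End DualCertificate.

(** * Certificates from generators of the vanishing ideal *)

Section GeneratorDegreeCertificate.
Context {R : realType} {n k : nat}.
Variable (xs : 'I_k -> 'rV[R]_n).
Hypothesis xs_inj : injective xs.

Let X : set 'rV[R]_n := range xs.

Lemma homogeneousM m (F G : {mpoly R[m]}) :
  homogeneous F -> homogeneous G -> homogeneous (F * G).
Proof. by move=> [d Fd] [e Ge]; exists (d + e)%N; exact: mpoly.dhomogM. Qed.

Lemma vanishing_ideal0 F x :
  vanishing_ideal X F -> X x -> peval F (homog_coord x) = 0.
Proof.
move=> [s sP ->] Xx; rewrite /peval raddf_sum big_seq big1// => q /sP[_ q0].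
by rewrite /= mpoly.mevalM [X in _ * X]q0// mulr0.
Qed.

(* The product over X of linear forms, one through each point of X and none
   through y. *)
Lemma vanishing_ideal_separates y : ~ X y ->
  exists2 F, vanishing_ideal X F & peval F (homog_coord y) != 0.
Proof.
move=> Xy.
have /choice[j jP] : forall i, exists j, y ord0 j != xs i ord0 j.
  move=> i; apply: contrapT => /forallNP h; apply: Xy; exists i => //.
  by apply/rowP => j; apply/eqP; have /negP := h j; rewrite negbK eq_sym.
pose U (l : 'I_(1 + n)) : {mpoly R[1 + n]} := mpoly.mpolyX R (mpoly.mnm1 l).
pose L i := U (rshift 1 (j i)) - xs i ord0 (j i) *: U (lshift n ord0).
have LE i x : peval (L i) (homog_coord x) = x ord0 (j i) - xs i ord0 (j i).
  rewrite /peval mpoly.mevalB mpoly.mevalZ !mpoly.mevalXU row_mxEr row_mxEl.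
  by rewrite mxE mulr1.
have Uhom l : U l \is mpoly.ishomog1 1 mpoly.mdeg.
  by rewrite mpoly.dhomogX /= mpoly.mdeg1.
have Lhom i : homogeneous (L i).
  by exists 1%N; rewrite rpredB ?rpredZ.
have EP x : peval (\prod_i L i) (homog_coord x) =
    \prod_i (x ord0 (j i) - xs i ord0 (j i)).
  by rewrite /peval rmorph_prod; apply: eq_bigr => i _; exact: LE.
exists (\prod_i L i); last first.
  by rewrite EP; apply/prodf_neq0 => i _; rewrite subr_eq0.
exists [:: (1, \prod_i L i)]; last by rewrite big_seq1 mul1r.
move=> q; rewrite inE => /eqP -> /=; split.
  apply: big_ind => //; last exact: homogeneousM.
  by exists 0%N; exact: mpoly.dhomog1.
by move=> _ [i _ <-]; rewrite EP (bigD1 i)//= subrr mul0r.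
Qed.

(** Dehomogenized generators have degree at most [g]. If all of them vanish at [y], so does the
    whole ideal, and [vanishing_ideal_separates] then puts [y] in [X]. *)
Lemma certified_generator_degree g i : is_generator_degree X g ->
  is_interpolation_degree X i -> certified xs (maxn (2 * g) i).
Proof.
move=> [G [_ GI _] gE] [iP _]; split; last first.
  move=> h.
  have [p pi pE] := iP (fun x => \sum_l h l * (x == xs l)%:R).
  exists (peval p).
    by exists p => //; apply: leq_trans pi _; rewrite ltnS leq_maxr.
  move=> l; rewrite pE; last by exists l.
  rewrite (bigD1 l)//= eqxx mulr1 big1 ?addr0// => m ml.
  by rewrite (inj_eq xs_inj) eq_sym (negbTE ml) mulr0.
exists (fun y => \sum_(F <- G | F \in G) peval F (homog_coord y) ^+ 2).
  apply: (@polyfunW _ _ (2 * g)); first exact: leq_maxl.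
  apply: polyfun_sum => F FG.
  apply: (@polyfunX _ _ g 2 (fun y => peval F (homog_coord y))).
  apply: (@polyfun_comp _ _ _ _ F (fun l y => homog_coord y ord0 l)) => [|l].
    rewrite /polys_deg_le /= gE.
    (* [msize] is the degree plus one, except for the zero polynomial, which the predecessor bound
       also covers. *)
    apply: leq_trans (leqSpred _) _; rewrite ltnS.
    exact: (@leq_bigmax_seq _ G xpredT (fun F => (msize F).-1)).
  case: (split_ordP l) => m ->.
    by apply: eq_polyfun (polyfun_cst _ 1) => y; rewrite row_mxEl mxE (ord1 m) eqxx.
  by apply: eq_polyfun (polyfun_coord m) => y; rewrite row_mxEr.
split=> y; first by apply: sumr_ge0 => F _; exact: sqr_ge0.
rewrite psumr_eq0; last by move=> F _; exact: sqr_ge0.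
apply/allP/existsP => [h|[l /eqP ->] F FG]; last first.
  apply/implyP => _; rewrite sqrf_eq0; apply/eqP/vanishing_ideal0; last by exists l.
  rewrite -GI; exists [:: (1, F)]; last by rewrite big_seq1 mul1r.
  by move=> q; rewrite inE => /eqP ->.
apply: contrapT => /forallNP ny.
have [F] : exists2 F, vanishing_ideal X F & peval F (homog_coord y) != 0.
  by apply: vanishing_ideal_separates => -[l _ yl]; apply: (ny l); rewrite yl.
rewrite -GI => -[s sG ->]; rewrite /peval raddf_sum big_seq big1 ?eqxx// => q qs.
have := h _ (sG _ qs); rewrite sG//= sqrf_eq0 => /eqP q0.
by rewrite mpoly.mevalM [X in _ * X]q0 mulr0.
Qed.

End GeneratorDegreeCertificate.

(** * Borel sets and continuous approximation *)

Lemma set_mem_cons (T : eqType) (x : T) (s : seq T) :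
  [set` x :: s] = [set x] `|` [set` s].
Proof.
apply/seteqP; split=> y /=; rewrite inE; first by move=> /predU1P[]; [left|right].
by move=> [->|->]; rewrite ?eqxx ?orbT.
Qed.

Section BorelSets.
Context {R : realType} {n : nat}.
Notation T := (borel R n).

Lemma borel_open (A : set 'rV[R]_n) : open A -> measurable (A : set T).
Proof. exact: sub_sigma_algebra. Qed.

Lemma borel_closed (A : set 'rV[R]_n) : closed A -> measurable (A : set T).
Proof. by move/closed_openC/borel_open/measurableC; rewrite setCK. Qed.

Lemma borel_compact (A : set 'rV[R]_n) : compact A -> measurable (A : set T).
Proof. by move/compact_closed => /(_ (@norm_hausdorff _ _))/borel_closed. Qed.

Lemma borel_set1 (x : 'rV[R]_n) : measurable ([set x] : set T).
Proof. by apply: borel_compact; exact: compact_set1. Qed.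

Lemma borel_finite (s : seq 'rV[R]_n) : measurable ([set` s] : set T).
Proof.
elim: s => [|x s IH]; first by rewrite set_nil; exact: measurable0.
by rewrite set_mem_cons; apply: measurableU => //; exact: borel_set1.
Qed.

Lemma borel_within_continuous (K : set 'rV[R]_n) (f : 'rV[R]_n -> R) :
  measurable (K : set T) -> {within K, continuous f} ->
  measurable_fun (K : set T) f.
Proof.
move=> mK /continuousP cf; apply: (measurability _ (RGenOpens.measurableE R)).
move=> _ [_ [a [b ->] <-]].
have /open_subspaceP[V oV VK] :=
  cf _ (@interval_open _ (BRight a) (BLeft b) erefl erefl).
rewrite setIC -[X in measurable X]VK.
by apply: measurableI => //; exact: borel_open.
Qed.

Lemma continuous_peval (p : {mpoly R[n]}) : continuous (peval p).
Proof.
rewrite (_ : peval p = fun y : 'rV[R]_n => \sum_(s <- mpoly.msupp p)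
    mpoly.mcoeff s p * \prod_i y ord0 i ^+ s i); last first.
  by apply/funext => y; rewrite /peval mpoly.mevalE.
apply: (@continuous_big R _ _ _ _ _ 'rV[R]_n) => [|s _]; first exact: add_continuous.
move=> x; apply: continuousM; first exact: cst_continuous.
move: x; apply: (@continuous_big R _ _ _ _ _ 'rV[R]_n) => [|i _ x].
  exact: mul_continuous.
apply: (@continuous_comp _ _ _ (fun y : 'rV[R]_n => y ord0 i) (fun z => z ^+ s i)).
  exact: coord_continuous.
exact: exprn_continuous.
Qed.

(* A form of Lusin's theorem: the sets with this property form a lambda-system
   containing the open sets. *)
Lemma indic_continuous_approx (mu : {measure set T -> \bar R}) (A : set T) :
  (mu setT < +oo)%E -> measurable A -> forall e : R, 0 < e ->
  exists (f : 'rV[R]_n -> R) (E : set T), [/\ continuous f,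
    forall x, 0 <= f x <= 1, measurable E, (mu E <= e%:E)%E &
    forall x, ~ E x -> f x = \1_A x].
Proof.
move=> mufin mA.
pose H : set (set T) := [set A | measurable A /\ forall e : R, 0 < e ->
  exists (f : 'rV[R]_n -> R) (E : set T), [/\ continuous f,
    forall x, 0 <= f x <= 1, measurable E, (mu E <= e%:E)%E &
    forall x, ~ E x -> f x = \1_A x]].
suff /(_ A mA)[] : <<s setT, @open 'rV[R]_n >> `<=` H by [].
have fin B : measurable B -> (mu B < +oo)%E.
  by move=> mB; apply: le_lt_trans mufin; apply: le_measure; rewrite ?inE.
(* Continuity from above of a finite measure: an increasing sequence exhausts its union up to small
   measure. *)
have nd (F : (set T)^nat) : (forall i, measurable (F i)) -> nondecreasing_seq F ->
    forall e : R, 0 < e -> exists m, (mu (\bigcup_i F i `\` F m) <= e%:E)%E.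
  move=> mF ndF e e0.
  have mUF : measurable (\bigcup_i F i) by exact: bigcupT_measurable.
  pose G m := \bigcup_i F i `\` F m.
  have mG m : measurable (G m) by exact: measurableD.
  have G0 : \bigcap_m G m = set0.
    rewrite -subset0 => x xG; have [[m _ Fmx] _] := xG 0%N I.
    by have [_] := xG m I.
  have : (mu \o G @ \oo --> mu (\bigcap_m G m))%E.
    apply: nonincreasing_cvg_mu => //; first exact: fin.
      by rewrite G0; exact: measurable0.
    by move=> i j ij; rewrite subsetEset; apply: setDS; rewrite -subsetEset; exact: ndF.
  rewrite G0 measure0 => /fine_cvgP[_ /cvgrPdist_le/(_ _ e0)[m _ /(_ m (leqnn _))]].
  rewrite sub0r normrN /= ger0_norm ?fine_ge0// => Gm.
  exists m; rewrite -[X in (X <= _)%E]fineK ?lee_fin// ge0_fin_numE//.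
  exact: fin (mG m).
apply: lambda_system_subset => //; first exact: openI.
- split=> //.
  + split=> // e e0; exists (fun=> 1), set0; split => //.
    * exact: cst_continuous.
    * by move=> x; rewrite ler01 lexx.
    * by rewrite measure0 lee_fin ltW.
    * by move=> x _; rewrite indicT.
  + move=> B C CB [mB HB] [mC HC]; split; first exact: measurableD.
    move=> e e0; have e20 : 0 < e / 2 by rewrite divr_gt0.
    have [f [E [cf f01 mE Ee fE]]] := HB _ e20.
    have [g [D [cg g01 mD De gD]]] := HC _ e20.
    (* As [C] lies in [B], the indicator of the difference is 1_B (1 - 1_C); each factor is allowed
       half of the error. *)
    exists (fun x => f x * (1 - g x)), (E `|` D); split.
    * by move=> x; exact: (cvgM (cf x) (cvgB (@cst_continuous _ _ (1 : R) x) (cg x))).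
    * move=> x; have /andP[? ?] := f01 x; have /andP[? ?] := g01 x.
      by rewrite mulr_ge0 ?subr_ge0//= mulr_ile1 ?subr_ge0// lerBlDr lerDl.
    * exact: measurableU.
    * rewrite (splitr e) EFinD; apply: le_trans (leeD Ee De).
      exact: measureU2.
    * move=> x /not_orP[Ex Dx]; rewrite fE// gD// !indicE in_setD.
      case: (x \in B); case: (x \in C);
      by rewrite /= ?subrr ?subr0 ?mulr0 ?mulr1 ?mul0r.
  + move=> F ndF FH; have mF i : measurable (F i : set T) by have [] := FH i.
    split; first exact: bigcupT_measurable.
    move=> e e0; have e20 : 0 < e / 2 by rewrite divr_gt0.
    have [m mm] := nd _ mF ndF _ e20.
    have [_ /(_ _ e20)[f [E [cf f01 mE Ee fE]]]] := FH m.
    have mD : measurable ((\bigcup_i F i `\` F m) : set T).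
      by apply: measurableD => //; exact: bigcupT_measurable.
    exists f, (E `|` (\bigcup_i F i `\` F m)); split => //.
    * exact: measurableU.
    * rewrite (splitr e) EFinD; apply: le_trans (leeD Ee mm).
      exact: measureU2.
    * move=> x /not_orP[Ex /not_andP Dx]; rewrite fE// !indicE.
      have [Fmx|nFmx] := pselect (F m x); first by rewrite !mem_set//; exists m.
      by rewrite !memNset//; case: Dx.
- move=> U oU; split; first exact: borel_open.
  (* The points at distance at least 1/(m+1) from the complement of [U]: closed sets increasing to
     [U]. A Urysohn function, 0 off [U] and 1 on [F m], is wrong at most on the rest of [U]. *)
  pose F m : set T := ~` \bigcup_(y in ~` U) ball (y : 'rV[R]_n) (m.+1%:R^-1).
  have cF m : closed (F m : set 'rV[R]_n).
    by apply: open_closedC; apply: bigcup_open => y _; exact: ball_open.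
  have mF m : measurable (F m) by exact: borel_closed.
  have UF : U = \bigcup_m F m.
    apply/seteqP; split=> [x Ux|x [m _ Fmx]]; last first.
      by apply: contrapT => nUx; apply: Fmx; exists x => //; exact: ballxx.
    have /nbhs_ballP[e /= e0 xe] := open_nbhs_nbhs (conj oU Ux).
    have [m me] : exists m, m.+1%:R^-1 < e.
      by exists (Num.truncn e^-1); rewrite invf_plt ?posrE// truncnS_gt.
    exists m => // -[y nUy yx]; apply: nUy; apply: xe.
    by apply: ball_sym; apply: le_ball yx; exact: ltW.
  have ndF : nondecreasing_seq F.
    move=> i j ij; rewrite subsetEset => x + [y Uy yx]; apply; exists y => //.
    by apply: le_ball yx; rewrite lef_pV2 ?posrE// ler_nat.
  move=> e e0; have [m mm] := nd _ mF ndF _ e0.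
  have sep : uniform_separator (~` U : set 'rV[R]_n) (F m : set 'rV[R]_n).
    apply: uniform_separatorW; exists [set xy | ball xy.1 (m.+1%:R^-1 : R) xy.2].
      by rewrite -entourage_ballE; exists m.+1%:R^-1 => /=.
    by rewrite -subset0 => -[a b] /= [[Ua Fb] ab]; apply: Fb; exists a.
  exists (Urysohn (~` U) (F m) : _ -> R), (\bigcup_i F i `\` F m); split => //.
  + exact: Urysohn_continuous.
  + move=> x; have /(_ (Urysohn (~` U) (F m) x)) := @Urysohn_range _ R (~` U) (F m).
    by rewrite /= in_itv /=; apply; exists x.
  + by apply: measurableD => //; exact: bigcupT_measurable.
  + rewrite -UF => x /not_andP Dx; rewrite indicE.
    have [Ux|nUx] := pselect (U x).
      rewrite mem_set//; apply: (@Urysohn_sub1 _ R _ _ sep); exists x => //.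
      by case: Dx => // /contrapT.
    by rewrite memNset//; apply: (@Urysohn_sub0 _ R _ _ sep); exists x.
Qed.

End BorelSets.

(** * Signed measures and total variation *)

Section PositiveCharges.
Context {R : realType} {n : nat}.
Notation T := (borel R n).
Implicit Types (nu : {charge set T -> \bar R}) (K : set 'rV[R]_n).

Lemma charge_jordanE nu A : measurable A ->
  nu A = (jordan_pos (hahnP nu) A - jordan_neg (hahnP nu) A)%E.
Proof. by move=> mA; rewrite [LHS](jordan_decomp (hahnP nu) mA) /cadd /= cscaleN1. Qed.

Lemma jordan_neg_ge0_charge nu A : (forall B, measurable B -> (0 <= nu B)%E) ->
  measurable A -> jordan_neg (hahnP nu) A = 0%E.
Proof.
move=> nu0 mA; have [_ [mN nN] _ _] := hahnP nu.
apply/eqP; rewrite eq_le measure_ge0 andbT jordan_negE cjordan_negE.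
rewrite /crestr0 mem_set// /crestr leeNl oppe0.
by apply: nu0; exact: measurableI.
Qed.

Lemma jordan_pos_ge0_charge nu A : (forall B, measurable B -> (0 <= nu B)%E) ->
  measurable A -> jordan_pos (hahnP nu) A = nu A.
Proof.
move=> nu0 mA; rewrite (charge_jordanE nu mA).
by rewrite [X in _ = (_ - X)%E]jordan_neg_ge0_charge// sube0.
Qed.

Lemma integrable_within_continuous (mu : {measure set T -> \bar R}) K f :
  (mu setT < +oo)%E -> compact K -> {within K, continuous f} ->
  mu.-integrable (K : set T) (EFin \o f).
Proof.
move=> mufin cK cf; have mK := borel_compact cK.
apply: measurable_bounded_integrable => //.
- by apply: le_lt_trans mufin; apply: le_measure; rewrite ?inE.
- exact: borel_within_continuous.
- have /compact_bounded[M [_ fM]] := continuous_compact cf cK.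
  by exists M; split; rewrite ?num_real// => ? ? ? ?; exact: fM.
Qed.

Lemma Rintegral_concentrated (mu : {measure set T -> \bar R}) K f (s : seq 'rV[R]_n) :
  measurable (K : set T) -> mu.-integrable (K : set T) (EFin \o f) ->
  uniq s -> [set` s] `<=` K -> mu (K `\` [set` s]) = 0%E ->
  (\int[mu]_(x in K) f x = \sum_(y <- s) f y * fine (mu [set y]))%R.
Proof.
move=> mK fI us sK muKs.
rewrite /Rintegral (negligible_integral (N := (K `\` [set` s] : set T)))//; last first.
  by apply: measurableD => //; exact: borel_finite.
rewrite setDD setIidr// -/(Rintegral mu [set` s] f).
elim: s us sK {muKs} => [_ _|x s IH /= /andP[xs us] sK].
  by rewrite set_nil Rintegral_set0 big_nil.
have sE : [set` x :: s] = ([set x] : set T) `|` [set` s] by exact: set_mem_cons.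
rewrite sE Rintegral_setU; last 4 first.
- exact: borel_set1.
- exact: borel_finite.
- apply: integrableS fI => //; last by rewrite -sE.
  by apply: measurableU; [exact: borel_set1|exact: borel_finite].
- apply/disj_setPS => y [/= -> ys]; by rewrite ys in xs.
rewrite big_cons IH//; last by move=> y ys; apply: sK => /=; rewrite inE ys orbT.
congr (_ + _); rewrite -Rintegral_cst//; last exact: borel_set1.
by apply: eq_Rintegral => y; rewrite inE => ->.
Qed.

Lemma ge0_charge_integral nu K f : compact K -> {within K, continuous f} ->
  (forall B, measurable B -> (0 <= nu B)%E) ->
  charge_integral nu K f = (\int[jordan_pos (hahnP nu)]_(x in K) f x)%R.
Proof.
move=> cK cf nu0; have mK := borel_compact cK.
rewrite /charge_integral [X in _ - X](_ : _ = 0) ?subr0//.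
rewrite /Rintegral null_set_integral//.
  by apply/measurable_EFinP; exact: borel_within_continuous.
exact: jordan_neg_ge0_charge.
Qed.

(** A bare set function, so that one formula serves measures and charges alike; the points may
    repeat. *)
Definition point_masses (I : finType) (c : I -> R) (y : I -> 'rV[R]_n)
  (A : set T) : \bar R := (\sum_i (c i)%:E * \d_(y i : T) A)%E.

Section PointMasses.
Context (I : finType) (c : I -> R) (y : I -> 'rV[R]_n).
Hypothesis c_ge0 : forall i, 0 <= c i.

Lemma measure_point_masses :
  exists mu : {measure set T -> \bar R}, forall A, mu A = point_masses c y A.
Proof.
suff [mu muE] : exists mu : {measure set T -> \bar R}, forall A,
    mu A = (\sum_(i <- index_enum I) (c i)%:E * \d_(y i : T) A)%E by exists mu.
elim: (index_enum I) => [|i r [mu IH]].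
  by exists (@mzero _ T R) => A; rewrite big_nil.
exists (measure_add (mscale (NngNum (c_ge0 i)) (\d_(y i : T))) mu) => A.
by rewrite big_cons -IH; exact: measure_addE.
Qed.

Lemma charge_point_masses :
  exists nu : {charge set T -> \bar R}, forall A, nu A = point_masses c y A.
Proof.
suff [nu nuE] : exists nu : {charge set T -> \bar R}, forall A,
    nu A = (\sum_(i <- index_enum I) (c i)%:E * \d_(y i : T) A)%E by exists nu.
elim: (index_enum I) => [|i r [nu IH]].
  by exists (@czero _ T R) => A; rewrite big_nil.
exists (cadd (cscale (c i) (charge_of_finite_measure (\d_(y i : T)))) nu) => A.
by rewrite big_cons -IH.
Qed.

Lemma point_masses_ge0 A : (0 <= point_masses c y A)%E.
Proof. by apply: sume_ge0 => i _; rewrite mule_ge0 ?lee_fin. Qed.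

Lemma point_masses_fin A : point_masses c y A \is a fin_num.
Proof. by apply/sum_fin_numP => i _; rewrite diracE. Qed.

Lemma fine_point_masses A : fine (point_masses c y A) = \sum_i c i * (y i \in A)%:R.
Proof.
rewrite /point_masses (eq_bigr (fun i => (c i * (y i \in A)%:R)%:E)).
  by rewrite sumEFin.
by move=> i _; rewrite diracE EFinM.
Qed.

Lemma Rintegral_point_masses (mu : {measure set T -> \bar R}) K f :
  (forall A, measurable A -> mu A = point_masses c y A) ->
  compact K -> {within K, continuous f} -> (forall i, K (y i)) ->
  (\int[mu]_(x in K) f x = \sum_i c i * f (y i))%R.
Proof.
move=> muE cK cf Ky; have mK := borel_compact cK.
(* Since points may repeat, the support is listed without duplicates and the weights are regrouped
   at each point. *)
pose s := undup (codom y).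
have ys i : y i \in s by rewrite mem_undup codom_f.
have mufin : (mu setT < +oo)%E.
  by rewrite muE ?ltey_eq ?point_masses_fin//; exact: measurableT.
rewrite (@Rintegral_concentrated mu K f s)//.
- transitivity (\sum_(x <- s) \sum_i f x * (c i * (y i \in [set x])%:R)).
    apply: eq_bigr => x _; rewrite muE; last exact: borel_set1.
    by rewrite fine_point_masses mulr_sumr.
  rewrite exchange_big; apply: eq_bigr => i _ /=.
  rewrite (bigD1_seq (y i))//= ?undup_uniq// big1 ?addr0.
    by rewrite mem_set// mulr1 mulrC.
  by move=> x xy; rewrite memNset ?mulr0// => yx; rewrite yx eqxx in xy.
- exact: integrable_within_continuous.
- exact: undup_uniq.
- by move=> x /=; rewrite mem_undup => /codomP[i ->].
- rewrite muE; last by apply: measurableD => //; exact: borel_finite.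
  rewrite /point_masses big1// => i _; rewrite diracE memNset ?mule0//.
  by move=> [_]; apply; rewrite /= ys.
Qed.

Lemma charge_integral_point_masses nu K f :
  (forall A, measurable A -> nu A = point_masses c y A) ->
  compact K -> {within K, continuous f} -> (forall i, K (y i)) ->
  charge_integral nu K f = \sum_i c i * f (y i).
Proof.
move=> nuE cK cf Ky.
have nu0 B : measurable B -> (0 <= nu B)%E.
  by move=> mB; rewrite nuE// point_masses_ge0.
rewrite ge0_charge_integral//; apply: Rintegral_point_masses => // A mA.
by rewrite -nuE//; exact: jordan_pos_ge0_charge.
Qed.

Lemma tv_norm_point_masses nu K :
  (forall A, measurable A -> nu A = point_masses c y A) ->
  compact K -> (forall i, K (y i)) -> (tv_norm K nu <= (\sum_i c i)%:E)%E.
Proof.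
move=> nuE cK Ky; apply: ge_ereal_sup => _ [g [cg g1] <-].
rewrite (charge_integral_point_masses nuE)// lee_fin; apply: ler_sum => i _.
by rewrite ler_piMr// (le_trans (ler_norm _))// g1.
Qed.

Lemma signed_measure_on_point_masses nu K :
  (forall A, measurable A -> nu A = point_masses c y A) ->
  compact K -> (forall i, K (y i)) -> signed_measure_on K nu.
Proof.
move=> nuE cK Ky A mA; rewrite !nuE//; last first.
  by apply: measurableI => //; exact: borel_compact.
by apply: eq_bigr => i _; rewrite !diracE in_setI (mem_set (Ky i)) andbT.
Qed.

End PointMasses.

(* By Lusin's theorem, 1 - g for a suitable continuous g is close to the
   indicator function of the negative part of nu. *)
Lemma charge_ge0_of_continuous nu K : compact K -> signed_measure_on K nu ->
  (forall g : 'rV[R]_n -> R, {within K, continuous g} ->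
     (forall x, K x -> `|g x| <= 1) ->
     charge_integral nu K g <= charge_integral nu K (fun=> 1)) ->
  forall A, measurable A -> (0 <= nu A)%E.
Proof.
move=> cK nuK nu1; have mK := borel_compact cK.
have [_ [mN _] _ PN] := hahnP nu.
set N := hahn_neg nu in mN PN.
pose a := jordan_pos (hahnP nu); pose b := jordan_neg (hahnP nu).
have afin : (a setT < +oo)%E by rewrite ltey_eq fin_num_measure.
have bfin : (b setT < +oo)%E by rewrite ltey_eq fin_num_measure.
have aN : a N = 0%E.
  by rewrite /a jordan_posE cjordan_posE /crestr0 mem_set// /crestr setIC PN charge0.
have bN A : measurable A -> b A = b (A `&` N).
  move=> mA; rewrite /b !jordan_negE !cjordan_negE /crestr0 !mem_set//;
    last exact: measurableI.
  by rewrite /crestr -setIA setIid.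
(* Testing the hypothesis against [1 - f] shows that the integral of [f] against [nu] is
   nonnegative. *)
have le_ab (f : 'rV[R]_n -> R) : continuous f -> (forall x, 0 <= f x <= 1) ->
    (\int[b]_(x in K) f x <= \int[a]_(x in K) f x)%R.
  move=> cf f01.
  have c1 : {within K, continuous (fun=> 1 : R)}.
    by apply: continuous_subspaceT; exact: cst_continuous.
  have cf' : {within K, continuous f} by exact: continuous_subspaceT.
  have := nu1 (fun x => 1 - f x).
  rewrite /charge_integral -/a -/b !RintegralB//;
    [|exact: integrable_within_continuous..].
  set u := (\int[a]_(x in K) f x)%R; set v := (\int[b]_(x in K) f x)%R.
  set p := (\int[a]_(x in K) 1)%R; set q := (\int[b]_(x in K) 1)%R.
  have H : p - u - (q - v) <= p - q -> v <= u by lra.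
  move=> h; apply/H/h.
    apply: continuous_subspaceT => x.
    exact: (cvgB (@cst_continuous _ _ (1 : R) x) (cf x)).
  move=> x _; have /andP[? ?] := f01 x.
  by rewrite ger0_norm ?subr_ge0// lerBlDr lerDl.
have bK : b K = 0%E.
  apply/eqP; rewrite eq_le measure_ge0 andbT leNgt; apply/negP => bK0.
  have bKfin : b K \is a fin_num by rewrite fin_num_measure.
  (* The approximation [f] of the indicator of [N] will have integral at most [e] against [a], but
     at least [b K - e = 2 * e] against [b], contradicting [le_ab]. *)
  pose e := fine (b K) / 3.
  have e0 : 0 < e by rewrite divr_gt0// fine_gt0// bK0 ltey_eq bKfin.
  (* Approximating with respect to the sum makes a single exceptional set small for both
     measures. *)
  pose ab : {measure set T -> \bar R} := measure_add a b.
  have abE A : ab A = (a A + b A)%E by exact: measure_addE.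
  have abfin : (ab setT < +oo)%E by rewrite abE lte_add_pinfty.
  have [f [E [cf f01 mE Ee fE]]] := indic_continuous_approx abfin mN e0.
  have cf' : {within K, continuous f} by exact: continuous_subspaceT.
  have aE : (a E <= e%:E)%E.
    by apply: le_trans Ee; rewrite abE leeDl.
  have bE : (b E <= e%:E)%E.
    by apply: le_trans Ee; rewrite abE leeDr.
  have mNE : measurable (N `|` E) by exact: measurableU.
  have af : (\int[a]_(x in K) f x <= e)%R.
    apply: (@le_trans _ _ (\int[a]_(x in K) \1_(N `|` E) x)%R).
      apply: le_Rintegral => //; first exact: integrable_within_continuous.
        by apply: integrableS (integrable_indic _ _) => //.
      move=> x Kx; have /andP[_ f1] := f01 x; rewrite indicE.
      have [NEx|/not_orP[Nx Ex]] := pselect ((N `|` E) x); first by rewrite mem_set.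
      by rewrite fE// indicE !memNset// => -[].
    rewrite /Rintegral integral_indic//.
    rewrite -lee_fin fineK; last by rewrite fin_num_measure//; exact: measurableI.
    apply: le_trans aE; rewrite -[leRHS]add0e -aN.
    apply: le_trans (measureU2 _ mN mE).
    by apply: le_measure; rewrite ?inE//; exact: measurableI.
  have bf : (fine (b (K `&` (N `\` E))) <= \int[b]_(x in K) f x)%R.
    apply: (@le_trans _ _ (\int[b]_(x in K) \1_(N `\` E) x)%R).
      rewrite /Rintegral integral_indic//; last exact: measurableD.
      by rewrite setIC.
    apply: le_Rintegral => //; last 2 first.
    - exact: integrable_within_continuous.
    - move=> x Kx; have /andP[f0 _] := f01 x; rewrite indicE.
      have [[Nx Ex]|NEx] := pselect ((N `\` E) x); last by rewrite memNset.
      by rewrite fE// indicE !mem_set.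
    - by apply: integrableS (integrable_indic _ _) => //; exact: measurableD.
  have : (b K <= b (K `&` (N `\` E)) + b E)%E.
    rewrite bN//; apply: le_trans (measureU2 _ _ mE).
      apply: le_measure; rewrite ?inE; first exact: measurableI.
        by apply: measurableU => //; apply: measurableI => //; exact: measurableD.
      move=> x [Kx Nx]; have [Ex|Ex] := pselect (E x); first by right.
      by left; split.
    by apply: measurableI => //; exact: measurableD.
  have mKNE : measurable (K `&` (N `\` E) : set T).
    by apply: measurableI => //; exact: measurableD.
  have bE' B : measurable B -> b B = (fine (b B))%:E.
    by move=> mB; rewrite fineK// fin_num_measure.
  rewrite (bE' _ mK) (bE' _ mKNE) (bE' _ mE) -EFinD lee_fin => bK3.
  have : fine (b E) <= e by rewrite -lee_fin fineK// fin_num_measure.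
  have := le_ab f cf f01; have : fine (b K) = 3 * e by rewrite /e; field.
  move: bK3 af bf e0; move: (fine (b K)) (fine (b E)) (fine (b (K `&` _))).
  move: (Rintegral b K f) (Rintegral a K f) (e); clear => *; lra.
move=> A mA; rewrite nuK// charge_jordanE; last exact: measurableI.
suff -> : jordan_neg (hahnP nu) (A `&` K) = 0%E by rewrite sube0 measure_ge0.
apply/eqP; rewrite eq_le measure_ge0 andbT -bK.
by apply: le_measure; rewrite ?inE//; exact: measurableI.
Qed.

End PositiveCharges.

(** * Minimizers *)

Section Minimizers.
Context {R : realType} {n : nat}.
Notation T := (borel R n).
Implicit Types (nu : {charge set T -> \bar R}) (mu : {measure set T -> \bar R}).
Context (K : set 'rV[R]_n) (cK : compact K) (d : nat).

Lemma within_continuous_peval (p : {mpoly R[n]}) : {within K, continuous (peval p)}.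
Proof. by apply: continuous_subspaceT; exact: continuous_peval. Qed.

Lemma within_continuous_cst (r : R) : {within K, continuous (fun=> r)}.
Proof. by apply: continuous_subspaceT; exact: cst_continuous. Qed.

Section TargetMeasure.
Context (I : finType) (c : I -> R) (y : I -> 'rV[R]_n) (mu : {measure set T -> \bar R}).
Hypotheses (c_ge0 : forall i, 0 <= c i) (Ky : forall i, K (y i)).
Hypothesis muE : forall A, measurable A -> mu A = point_masses c y A.

(** The constant 1 has degree 0, so the total mass is among the prescribed moments for every [d]. *)
Lemma feasible_integral1 nu : feasible K d mu nu ->
  charge_integral nu K (fun=> 1) = \sum_i c i.
Proof.
move=> [_ nuE].
have p1 : peval (1 : {mpoly R[n]}) = fun=> 1.
  by apply/funext => x; rewrite /peval mpoly.meval1.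
have := nuE 1; rewrite p1 => ->; last first.
  by rewrite /polys_deg_le /= mpoly.mmeasure1.
rewrite (Rintegral_point_masses muE)//; last exact: within_continuous_cst.
by apply: eq_bigr => i _; rewrite mulr1.
Qed.

Lemma feasible_tv_norm_ge nu : feasible K d mu nu ->
  ((\sum_i c i)%:E <= tv_norm K nu)%E.
Proof.
move=> fnu; rewrite -(feasible_integral1 fnu).
apply: ereal_sup_ubound; exists (fun=> 1) => //; split.
  exact: within_continuous_cst.
by move=> x _; rewrite normr1.
Qed.

(** A positive combination has norm at most its mass, so it attains the lower bound
    [feasible_tv_norm_ge]. Its points may differ from those of [mu], which is how uniqueness will be
    refuted. *)
Lemma point_masses_minimizer (J : finType) (c' : J -> R) (y' : J -> 'rV[R]_n) nu :
  (forall j, 0 <= c' j) -> (forall j, K (y' j)) ->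
  (forall A, measurable A -> nu A = point_masses c' y' A) ->
  (forall p : {mpoly R[n]}, polys_deg_le d p ->
     \sum_j c' j * peval p (y' j) = \sum_i c i * peval p (y i)) ->
  minimizer K d mu nu.
Proof.
move=> c'0 Ky' nuE mom.
have fnu : feasible K d mu nu.
  split; first exact: (signed_measure_on_point_masses nuE).
  move=> p pd; rewrite (Rintegral_point_masses muE)//;
    last exact: within_continuous_peval.
  rewrite (charge_integral_point_masses c'0 nuE)// ?mom//.
  exact: within_continuous_peval.
split=> // nu' fnu'; apply: le_trans (feasible_tv_norm_ge fnu').
rewrite -(feasible_integral1 fnu).
rewrite (charge_integral_point_masses c'0 nuE)//; last exact: within_continuous_cst.
under eq_bigr do rewrite mulr1.
exact: (tv_norm_point_masses c'0 nuE).
Qed.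

(** The masses of [mu] themselves are feasible, so a minimizer has norm at most its integral of 1.
    Hence the test function 1 attains the norm. *)
Lemma minimizer_ge0 nu : minimizer K d mu nu ->
  forall A, measurable A -> (0 <= nu A)%E.
Proof.
move=> [fnu nu_min]; have [nuK _] := fnu.
apply: charge_ge0_of_continuous nuK _ => // g cg g1.
have [nu0 nu0E] := charge_point_masses c y.
have [fnu0 _] : minimizer K d mu nu0.
  by apply: (@point_masses_minimizer _ c y) => // A _; exact: nu0E.
rewrite -lee_fin (feasible_integral1 fnu).
have nu0c : (tv_norm K nu0 <= (\sum_i c i)%:E)%E.
  by apply: (@tv_norm_point_masses _ _ _ c y) => // A _; exact: nu0E.
apply: le_trans (le_trans (nu_min _ fnu0) nu0c).
by apply: ereal_sup_ubound; exists g.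
Qed.

End TargetMeasure.

Lemma certified_unique_solution (k : nat) (xs : 'I_k -> 'rV[R]_n) (c : 'I_k -> R) mu :
  injective xs -> certified xs d -> (forall i, K (xs i)) -> (forall i, 0 <= c i) ->
  (forall A, measurable A -> mu A = point_masses c xs A) ->
  unique_solution K d mu.
Proof.
move=> xs_inj [[_ [p pd /funext <-] [f0 fX]] interp] Kxs c0 muE.
have mK := borel_compact cK.
have [nu0 nu0E] := charge_point_masses c xs.
exists nu0.
  by apply: (point_masses_minimizer Kxs muE c0 Kxs) => // A _; exact: nu0E.
move=> nu nu_min A mA; rewrite nu0E.
have nu_ge0 := minimizer_ge0 c0 Kxs muE nu_min.
have [[nuK nu_mom] _] := nu_min.
pose m : {measure set T -> \bar R} := jordan_pos (hahnP nu).
have mE B : measurable B -> m B = nu B by exact: jordan_pos_ge0_charge.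
have mfin : (m setT < +oo)%E.
  by rewrite mE ?ltey_eq ?fin_num_measure//; exact: measurableT.
have mint q : polys_deg_le d q ->
    (\int[m]_(x in K) peval q x = \sum_i c i * peval q (xs i))%R.
  move=> qd; rewrite -ge0_charge_integral//; last exact: within_continuous_peval.
  rewrite nu_mom// (Rintegral_point_masses muE)//.
  exact: within_continuous_peval.
pose s := codom xs.
have us : uniq s by apply/injectiveP.
have sK : [set` s] `<=` K by move=> x /codomP[i ->].
have pI := integrable_within_continuous mfin cK (@within_continuous_peval p).
(* The nonnegative [p] has integral 0 because it vanishes at every [xs i]; so it is zero almost
   everywhere, and its zeros are exactly the points. *)
have ms : m (K `\` [set` s]) = 0%E.
  have : (\int[m]_(x in K) (peval p x)%:E = 0)%E.
    rewrite -[LHS]fineK; last exact: integrable_fin_num pI.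
    have := mint p pd; rewrite /Rintegral => ->; rewrite big1// => i _.
    suff /eqP -> : peval p (xs i) == 0 by rewrite mulr0.
    by rewrite fX; apply/existsP; exists i.
  rewrite (eq_integral (fun x : T => `|(peval p x)%:E|%E)); last first.
    by move=> x _; rewrite gee0_abs// lee_fin.
  move/ae_eq_integral_abs => /(_ mK); case.
    apply/measurable_EFinP; apply: borel_within_continuous => //.
    exact: within_continuous_peval.
  move=> E [mE' E0 KE]; apply: subset_measure0 mE' _ E0.
    by apply: measurableD => //; exact: borel_finite.
  move=> x [Kx xs_x]; apply: KE => /= /(_ Kx) [] px0; apply: xs_x => /=.
  have /eqP := px0; rewrite fX => /existsP[i /eqP ->]; exact: codom_f.
(* The moment of a polynomial interpolating the Kronecker delta at [i] reads off the weight at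
   [xs i]. *)
have mx i : fine (m [set xs i]) = c i.
  have [_ [q qd /funext <-] qi] := interp (fun j => (j == i)%:R).
  have := mint q qd; rewrite (@Rintegral_concentrated _ _ m K _ s)//; last first.
    by apply: integrable_within_continuous => //; exact: within_continuous_peval.
  rewrite big_map big_enum /= (bigD1 i)//= [RHS](bigD1 i)//= !qi eqxx mulr1 mul1r.
  rewrite !big1 ?addr0// => j ji; by rewrite qi (negbTE ji) ?mulr0 ?mul0r.
have mKA : measurable (A `&` K) by exact: measurableI.
rewrite nuK// -[LHS]fineK ?fin_num_measure//.
rewrite -[RHS]fineK ?point_masses_fin//; congr EFin.
rewrite fine_point_masses.
have -> : fine (nu (A `&` K)) = (\int[m]_(x in K) (\1_A x : R))%R.
  by rewrite -mE// /Rintegral integral_indic.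
rewrite (@Rintegral_concentrated _ _ m K _ s)//; last first.
  apply: measurable_bounded_integrable => //.
    by apply: le_lt_trans mfin; apply: le_measure; rewrite ?inE.
  exists 1; split; rewrite ?num_real// => M M1 x _ /=.
  rewrite indicE ger0_norm//; apply: le_trans (ltW M1).
  by case: (_ \in _); rewrite ?ler01.
by rewrite big_map big_enum; apply: eq_bigr => i _; rewrite mx mulrC.
Qed.

End Minimizers.

(** * Difference quotients at the points *)

Lemma poly_near0_gt0 (R : realType) (q : {poly R}) : 0 < q.[0] ->
  \forall h \near 0^'+, 0 < q.[h].
Proof.
move=> q0; have : q.[h] @[h --> (0 : R)^'+] --> q.[0].
  by apply: cvg_at_right_filter; exact: continuous_horner.
by move/cvgr_gt; apply.
Qed.

(* A polynomial deformation of the linear system c0 M(0) = tau(0), solvable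
   without inverting the determinant D thanks to the adjugate matrix. *)
Lemma row_full_deformation (F : fieldType) r s (M : 'M[{poly F}]_(r, s))
    (tau : 'rV[{poly F}]_s) (c0 : 'rV[F]_r) :
  row_full (map_mx (horner_eval 0) M) ->
  c0 *m map_mx (horner_eval 0) M = map_mx (horner_eval 0) tau ->
  exists (N : 'rV[{poly F}]_r) (D : {poly F}),
    [/\ N *m M = D *: tau, D.[0] = 1 & forall i, (N ord0 i).[0] = c0 ord0 i].
Proof.
move=> /row_fullP[B BM] cM.
pose W := map_mx polyC B *m M; pose c := map_mx polyC c0.
(* After multiplication by [M], the adjugate turns the second term into det W (tau - c M), which
   corrects the first to det W tau. At 0 the correction vanishes because [c0] solves the system
   there. *)
pose N := \det W *: c + (tau - c *m M) *m \adj W *m map_mx polyC B.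
have PK a b (A : 'M[F]_(a, b)) : map_mx (horner_eval 0) (map_mx polyC A) = A.
  by apply/matrixP => i j; rewrite !mxE /horner_eval hornerC.
have W0 : map_mx (horner_eval 0) W = 1%:M by rewrite map_mxM PK.
have D0 : (\det W).[0] = 1.
  by have := det_map_mx (horner_eval 0) W; rewrite W0 det1.
exists N, (\det W); split=> //.
  rewrite mulmxDl -scalemxAl -[in X in _ + X]mulmxA -/W -mulmxA mul_adj_mx.
  by rewrite mul_mx_scalar -scalerDr addrC subrK.
move=> i; transitivity (map_mx (horner_eval 0) N ord0 i).
  by rewrite [RHS]mxE.
rewrite map_mxD map_mxZ !map_mxM map_mxB map_mxM !PK cM subrr !mul0mx addr0.
by rewrite /= /horner_eval D0 scale1r.
Qed.

Section Perturbation.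
Context {R : realType} {n : nat}.
Implicit Types (x : 'rV[R]_n) (p : {mpoly R[n]}).

Definition shift_coord x (j : 'I_n) (h : R) : 'rV[R]_n := x + h *: delta_mx 0 j.

(** The difference quotient is a polynomial in the step, hence also meaningful at step 0, where it
    is the partial derivative, and at negative steps. This passes from constants and variables to
    sums and products. *)
Lemma peval_shift p x j : exists q : {poly R},
  (forall h, peval p (shift_coord x j h) = peval p x + h * q.[h]) /\
  q.[0] = peval (mpoly.mderiv j p) x.
Proof.
pose P p := exists q : {poly R},
  (forall h, peval p (shift_coord x j h) = peval p x + h * q.[h]) /\
  q.[0] = peval (mpoly.mderiv j p) x.
have PC c : P (mpoly.mpolyC n c).
  exists 0; split=> [h|].
    by rewrite /peval !mpoly.mevalC horner0 mulr0 addr0.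
  by rewrite horner0 /peval mpoly.mderivC mpoly.meval0.
have PD p1 p2 : P p1 -> P p2 -> P (p1 + p2).
  move=> [q1 [E1 Z1]] [q2 [E2 Z2]]; exists (q1 + q2); split=> [h|].
    rewrite /peval !mpoly.mevalD hornerD mulrDr addrACA -!/(peval _ _).
    by rewrite E1 E2.
  by rewrite hornerD Z1 Z2 /peval mpoly.mderivD mpoly.mevalD.
have PM p1 p2 : P p1 -> P p2 -> P (p1 * p2).
  move=> [q1 [E1 Z1]] [q2 [E2 Z2]].
  exists (q1 * (peval p2 x)%:P + (peval p1 x)%:P * q2 + 'X * q1 * q2).
  split=> [h|].
    rewrite /peval !mpoly.mevalM -!/(peval _ _) E1 E2 !hornerE; ring.
  rewrite !hornerE Z1 Z2 /peval mpoly.mderivM mpoly.mevalD !mpoly.mevalM.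
  by rewrite ?mul0r ?addr0.
have PX i : P (mpoly.mpolyX R (mpoly.mnm1 i)).
  exists (i == j)%:R%:P; split=> [h|].
    by rewrite /peval !mpoly.mevalXU hornerC !mxE eqxx /= eq_sym.
  rewrite hornerC /peval mpoly.mderivX mpoly.mevalZ mpoly.mnm1E.
  have [->|_] := eqVneq i j; last by rewrite mul0r.
  by rewrite -{1}[mpoly.mnm1 j]mpoly.add0m mpoly.addmK mpoly.mpolyX0 mpoly.meval1 mulr1.
have P1 : P 1 by exact: PC 1.
rewrite -/(P p); elim/mpoly.mpolyind: p => [|c m p _ _ Pp]; first exact: PC 0.
apply: PD => //; rewrite -mpoly.mul_mpolyC; apply: (PM); first exact: PC.
rewrite mpoly.mpolyXE_id; apply: (big_ind P P1 PM) => i _.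
by elim: (m i) => [|k IH]; rewrite ?expr0 ?exprS//; apply: (PM).
Qed.

Context {k : nat} (xs : 'I_k -> 'rV[R]_n) (d : nat).

Let mono := mpoly.bmultinom n d.+1.

Let X (m : mono) : {mpoly R[n]} := mpoly.mpolyX R (mpoly.bmnm m).

Lemma monomial_linear_eq (I : finType) (c : I -> R) (y : I -> 'rV[R]_n) :
  (forall m : mono, \sum_i c i * peval (X m) (y i) = 0) ->
  forall p, polys_deg_le d p -> \sum_i c i * peval p (y i) = 0.
Proof.
move=> H p pd; rewrite (mpoly.mpolywE pd).
under eq_bigr => i _.
  rewrite /peval raddf_sum mulr_sumr.
  under eq_bigr => m _ do rewrite /= mpoly.mevalZ mulrCA.
  over.
rewrite exchange_big big1// => m _; rewrite -mulr_sumr.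
by have := H m; rewrite /peval /X => ->; rewrite mulr0.
Qed.

(* If no nonzero polynomial of degree <= d is singular along the points, the
   evaluations at the points and the partial derivatives there span the dual of
   the space of polynomials of degree <= d. Replacing derivatives by difference
   quotients with a small step h preserves this. *)
Lemma difference_relation :
  (forall p, polys_deg_le d p -> singular_along (range xs) p -> p = 0) ->
  \forall h \near 0^'+, exists (a : 'I_k -> R) (b : 'I_k * 'I_n -> R) (D : R),
    [/\ 0 < D, forall ij, 0 < b ij & forall p, polys_deg_le d p ->
      \sum_i a i * peval p (xs i) =
      \sum_ij (b ij * peval p (shift_coord (xs ij.1) ij.2 h) +
               D * peval p (shift_coord (xs ij.1) ij.2 (- h)))].
Proof.
move=> nosing.
have /choice[Q QP] : forall t : ('I_k * 'I_n) * mono, exists q : {poly R},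
    (forall h, peval (X t.2) (shift_coord (xs t.1.1) t.1.2 h) =
       peval (X t.2) (xs t.1.1) + h * q.[h]) /\
    q.[0] = peval (mpoly.mderiv t.1.2 (X t.2)) (xs t.1.1).
  by move=> t; exact: peval_shift.
(* Rows are functionals and columns are monomials. Entries are polynomials in the step; at 0 the
   difference quotients become derivatives. *)
pose row (u : 'I_k + 'I_k * 'I_n) (m : mono) : {poly R} :=
  match u with inl i => (peval (X m) (xs i))%:P | inr ij => Q (ij, m) end.
pose M := \matrix_(u < #|{: 'I_k + 'I_k * 'I_n}|, m < #|{: mono}|)
  row (enum_val u) (enum_val m).
(* The target is the sum of the quotients with opposite step. At 0 both kinds of quotient agree, so
   weight 1 on every derivative row, and 0 on evaluations, solves the system. *)
pose tau := \row_(m < #|{: mono}|) (\sum_ij (Q (ij, enum_val m) \Po (- 'X)))%R.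
pose c0 := \row_(u < #|{: 'I_k + 'I_k * 'I_n}|)
  (if enum_val u is inr _ then 1 else 0 : R).
have sumE (V : nmodType) (G : 'I_k + 'I_k * 'I_n -> V) :
    \sum_(u < #|{: 'I_k + 'I_k * 'I_n}|) G (enum_val u) =
    \sum_i G (inl i) + \sum_ij G (inr ij).
  by rewrite -big_enum_val big_sumType.
(* A vector orthogonal to all rows at 0 is the coefficient vector of a polynomial singular along the
   points. *)
have fullM : row_full (map_mx (horner_eval 0) M).
  suff: row_free (map_mx (horner_eval 0) M)^T by rewrite /row_free mxrank_tr.
  apply: inj_row_free => v vM.
  pose p : {mpoly R[n]} := \sum_m v ord0 m *: X (enum_val m).
  have vM' u : \sum_m v ord0 m * (row u (enum_val m)).[0] = 0.
    have /rowP/(_ (enum_rank u)) := vM; rewrite !mxE => vM0.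
    rewrite -[RHS]vM0; apply: eq_bigr => m _.
    by rewrite !mxE enum_rankK.
  have p0 : p = 0.
    apply: nosing.
      rewrite /polys_deg_le /=; apply: leq_trans (mpoly.msize_sum _ _ _) _.
      apply/bigmax_leqP_seq => m _ _; apply: leq_trans (mpoly.msizeZ_le _ _) _.
      by rewrite mpoly.msizeX; exact: mpoly.bmdeg.
    move=> _ [i _ <-]; split=> [|j].
      rewrite /peval raddf_sum -[RHS](vM' (inl i)); apply: eq_bigr => m _ /=.
      by rewrite mpoly.mevalZ hornerC.
    have -> : mpoly.mderiv j p =
        \sum_m v ord0 m *: mpoly.mderiv j (X (enum_val m)).
      by rewrite /p [LHS]raddf_sum; apply: eq_bigr => m _; exact: mpoly.mderivZ.
    rewrite /peval raddf_sum -[RHS](vM' (inr (i, j))); apply: eq_bigr => m _ /=.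
    by rewrite mpoly.mevalZ (QP (_, _)).2.
  apply/rowP => m; rewrite mxE.
  have := congr1 (mpoly.mcoeff (mpoly.bmnm (enum_val m))) p0.
  rewrite mpoly.mcoeff0 => <-; rewrite /p raddf_sum (bigD1 m)//=.
  rewrite mpoly.mcoeffZ mpoly.mcoeffX eqxx mulr1 big1 ?addr0// => m' m'm.
  rewrite mpoly.mcoeffZ mpoly.mcoeffX -mpoly.bmeqP (inj_eq enum_val_inj).
  by rewrite (negbTE m'm) mulr0.
have c0M : c0 *m map_mx (horner_eval 0) M = map_mx (horner_eval 0) tau.
  apply/rowP => m; rewrite !mxE.
  pose G (w : 'I_k + 'I_k * 'I_n) : R :=
    (if w is inr _ then 1 else 0) * (row w (enum_val m)).[0].
  transitivity (\sum_(u < #|{: 'I_k + 'I_k * 'I_n}|) G (enum_val u)).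
    by apply: eq_bigr => u _; rewrite !mxE.
  rewrite sumE big1 ?add0r => [|i _]; last by rewrite /G mul0r.
  rewrite /horner_eval horner_sum; apply: eq_bigr => ij _.
  by rewrite /G mul1r horner_comp hornerN hornerX oppr0.
have [N [D [NM D0 N0]]] := row_full_deformation fullM c0M.
have Nnear : \forall h \near 0^'+, forall ij, 0 < (N ord0 (enum_rank (inr ij))).[h].
  apply: filter_forall => ij; apply: poly_near0_gt0.
  by rewrite N0 mxE enum_rankK ltr01.
have Dnear : \forall h \near 0^'+, 0 < D.[h] by apply: poly_near0_gt0; rewrite D0.
have := nbhs_right_gt (0 : R).
apply: filterS3 Nnear Dnear => h Nh Dh h0.
(* Multiplied by [h], the relation [N *m M = D *: tau] involves forward differences on the left and
   backward ones on the right. Thus both kinds of shifted points get positive weights once moved to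
   one side, and [a] collects what remains at the points themselves. *)
pose a i := \sum_(j < n) ((N ord0 (enum_rank (inr (i, j)))).[h] + D.[h]) -
            h * (N ord0 (enum_rank (inl i))).[h].
exists a, (fun ij => (N ord0 (enum_rank (inr ij))).[h]), D.[h]; split=> //.
move=> p pd; apply/eqP; rewrite -subr_eq0; apply/eqP.
pose c (u : 'I_k + ('I_k * 'I_n) * bool) := match u with
  | inl i => a i
  | inr (ij, true) => - (N ord0 (enum_rank (inr ij))).[h]
  | inr (ij, false) => - D.[h] end.
pose y (u : 'I_k + ('I_k * 'I_n) * bool) := match u with
  | inl i => xs i
  | inr (ij, b) => shift_coord (xs ij.1) ij.2 (if b then h else - h) end.
have cyE q : \sum_i a i * peval q (xs i) -
    \sum_ij ((N ord0 (enum_rank (inr ij))).[h] *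
               peval q (shift_coord (xs ij.1) ij.2 h) +
             D.[h] * peval q (shift_coord (xs ij.1) ij.2 (- h))) =
    \sum_u c u * peval q (y u).
  rewrite big_sumType /=; congr (_ + _).
  pose G ij b := c (inr (ij, b)) * peval q (y (inr (ij, b))).
  rewrite [RHS](eq_bigr (fun t => G t.1 t.2)); last by case=> ? [].
  rewrite -(pair_bigA _ G) {}/G /=.
  rewrite -sumrN; apply: eq_bigr => ij _.
  by rewrite big_bool /= !mulNr opprD.
rewrite cyE; apply: monomial_linear_eq pd => m; rewrite -cyE.
pose P i := peval (X m) (xs i).
have EQ : \sum_i (N ord0 (enum_rank (inl i))).[h] * P i +
    \sum_ij (N ord0 (enum_rank (inr ij))).[h] * (Q (ij, m)).[h] =
    D.[h] * \sum_ij (Q (ij, m)).[- h].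
  transitivity ((N *m M) ord0 (enum_rank m)).[h].
    rewrite mxE horner_sum.
    pose G (w : 'I_k + 'I_k * 'I_n) := (N ord0 (enum_rank w)).[h] * (row w m).[h].
    transitivity (\sum_(u < #|{: 'I_k + 'I_k * 'I_n}|) G (enum_val u)).
      by rewrite sumE; congr (_ + _); apply: eq_bigr => i _; rewrite /G /= hornerC.
    by apply: eq_bigr => u _; rewrite /G enum_valK !mxE hornerM enum_rankK.
  rewrite NM mxE mxE hornerM horner_sum; congr (_ * _); apply: eq_bigr => ij _.
  by rewrite horner_comp hornerN hornerX enum_rankK.
have -> : \sum_ij ((N ord0 (enum_rank (inr ij))).[h] *
               peval (X m) (shift_coord (xs ij.1) ij.2 h) +
             D.[h] * peval (X m) (shift_coord (xs ij.1) ij.2 (- h))) =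
    \sum_i (\sum_j ((N ord0 (enum_rank (inr (i, j)))).[h] + D.[h])) * P i +
    h * (\sum_ij (N ord0 (enum_rank (inr ij))).[h] * (Q (ij, m)).[h] -
         D.[h] * \sum_ij (Q (ij, m)).[- h]).
  rewrite mulr_sumr -sumrB mulr_sumr.
  under [X in _ = X + _]eq_bigr do rewrite mulr_suml.
  rewrite pair_bigA -big_split /=; apply: eq_bigr => -[i j] _ /=.
  rewrite !(QP (i, j, m)).1 /= /P; ring.
rewrite -EQ; under eq_bigr do rewrite mulrBl -mulrA.
rewrite sumrB -mulr_sumr; ring.
Qed.


End Perturbation.

(** * Bounds on the uniqueness degree *)

Lemma is_least_exists (P : nat -> Prop) m :
  P m -> exists d, is_least P d.
Proof.
move=> Pm; have exP : exists d, `[< P d >] by exists m; apply/asboolP.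
case: (ex_minnP exP) => d /asboolP Pd dmin; exists d; split=> // e Pe.
by apply: dmin; apply/asboolP.
Qed.

Section UniquenessDegreeBounds.
Context {R : realType} {n k : nat} (K : set 'rV[R]_n) (cK : compact K).
Variable (xs : 'I_k -> 'rV[R]_n).
Hypothesis xs_inj : injective xs.
Notation T := (borel R n).
Implicit Types (mu : {measure set T -> \bar R}).

Let unique_recovery d := forall mu, positive_discrete (range xs) mu ->
  unique_solution K d mu.

Lemma fsbig_range (F : 'rV[R]_n -> \bar R) :
  (\sum_(x \in range xs) F x = \sum_i F (xs i))%E.
Proof.
have -> : range xs = [set` codom xs].
  apply/seteqP; split=> [_ [i _ <-]|_ /codomP[i ->]]; last by exists i.
  exact: codom_f.
by rewrite -fsbig_seq ?big_map ?big_enum//; apply/injectiveP.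
Qed.

Lemma positive_discrete_range mu : positive_discrete (range xs) mu ->
  exists2 c : 'I_k -> R, (forall i, 0 <= c i) &
    forall A, measurable A -> mu A = point_masses c xs A.
Proof.
move=> [c c0 muE]; exists (c \o xs) => [i|A mA]; first exact: c0.
by rewrite muE// fsbig_range.
Qed.

Lemma certified_unique_recovery d : (forall i, K (xs i)) -> certified xs d ->
  unique_recovery d.
Proof.
move=> Kxs cert mu /positive_discrete_range[c c0 muE].
exact: certified_unique_solution cert _ _ muE.
Qed.

Lemma shift_coord_cvg x (j : 'I_n) :
  shift_coord x j h @[h --> (0 : R)^'+] --> x /\
  shift_coord x j (- h) @[h --> (0 : R)^'+] --> x.
Proof.
have c0 : shift_coord x j h @[h --> (0 : R)] --> x.
  have := cvgD (cvg_cst x) (@scalel_continuous _ _ (delta_mx 0 j : 'rV[R]_n) 0).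
  by rewrite scale0r addr0; apply.
split; apply: cvg_at_right_filter => //.
have oc : - h @[h --> (0 : R)] --> (0 : R).
  by have := cvgN (@cvg_id R (nbhs (0 : R))); rewrite oppr0; apply.
exact: cvg_comp oc c0.
Qed.

Lemma shift_coord_near_interior : (forall i, interior K (xs i)) ->
  \forall h \near (0 : R)^'+, forall ij : 'I_k * 'I_n,
    K (shift_coord (xs ij.1) ij.2 h) /\ K (shift_coord (xs ij.1) ij.2 (- h)).
Proof.
move=> xsK; apply: filter_forall => -[i j] /=.
have [c1 c2] := shift_coord_cvg (xs i) j.
by apply: filterI; [apply: c1|apply: c2]; exact: xsK.
Qed.

(** On a coordinate line through [xs i0], each [xs i] is met for at most one step [r], which small
    positive steps avoid. *)
Lemma shift_coord_near_notin i0 (j0 : 'I_n) :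
  \forall h \near (0 : R)^'+, forall i, shift_coord (xs i0) j0 h != xs i.
Proof.
apply: filter_forall => i; pose r := xs i ord0 j0 - xs i0 ord0 j0.
have : \forall h \near (0 : R)^'+, h != r.
  have [r0|r0] := leP r 0.
    by near=> h; rewrite gt_eqF// (le_lt_trans r0)//; near: h; exact: nbhs_right_gt.
  by near=> h; rewrite lt_eqF//; near: h; exact: nbhs_right_lt.
apply: filterS => h; apply: contraNneq => /rowP/(_ j0).
by rewrite !mxE !eqxx /= mulr1 /r => <-; rewrite addrAC subrr add0r.
Unshelve. all: by end_near. Qed.

Lemma singular_degree_le d l : (forall i, interior K (xs i)) ->
  unique_recovery d -> is_singular_degree (range xs) l -> (l <= d)%N.
Proof.
move=> xsK uniq_d [[p pl psing] lmin].
(* Without variables every polynomial is constant, so [l] is 0. *)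
have [n0|n_gt0] := posnP n.
  suff : (msize p <= 1)%N by rewrite pl ltnS leqn0 => /eqP ->.
  apply/bigmax_leqP_seq => m _ _; rewrite ltnS leqn0 /= mpoly.mdegE.
  by rewrite big1// => -[j jn]; exfalso; move: jn; rewrite n0.
(* Without points the constant 1 is vacuously singular, so again [l] is 0. *)
have [k0|k_gt0] := posnP k.
  apply: leq_trans (lmin 0%N _) (leq0n d); exists 1; first exact: mpoly.mmeasure1.
  by move=> x [i _ _]; have := leq_trans (ltn_ord i) (eq_leq k0).
pose i0 := Ordinal k_gt0; pose j0 := Ordinal n_gt0.
rewrite leqNgt; apply/negP => dl.
have nosing q : polys_deg_le d q -> singular_along (range xs) q -> q = 0.
  move=> qd qsing; apply/eqP; apply: contraT => q0.
  suff : (l <= d)%N by rewrite leqNgt dl.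
  have := mpoly.mpolySpred mpoly.mdeg q0 => qE.
  apply: leq_trans (lmin (msize q).-1 _) _; first by exists q.
  by rewrite -ltnS -qE.
have [h [[h0 h1] [h2 [a [b [D [D0 b0 rel]]]]]]] := filter_ex (filterI
  (filterI (nbhs_right_gt (0 : R)) (shift_coord_near_interior xsK))
  (filterI (shift_coord_near_notin i0 j0) (difference_relation nosing))).
have xsK' i : K (xs i) by exact: interior_subset (xsK i).
(* Mass [t] at each point dominates every [a i], so trading the part [a] for masses at the shifted
   points leaves nonnegative weights. *)
pose t := 1 + \sum_i `|a i|.
have t0 : 0 <= t by rewrite addr_ge0// sumr_ge0.
pose J := ('I_k + ('I_k * 'I_n) * bool)%type.
pose c' (u : J) := match u with
  | inl i => t - a i | inr (ij, true) => b ij | inr (ij, false) => D end.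
pose y' (u : J) := match u with
  | inl i => xs i
  | inr (ij, e) => shift_coord (xs ij.1) ij.2 (if e then h else - h) end.
have c'0 u : 0 <= c' u.
  case: u => [i|[ij []]] /=; [|exact: ltW (b0 ij)|exact: ltW].
  rewrite subr_ge0 (le_trans (ler_norm _))// /t (bigD1 i)//= addrCA lerDl.
  by rewrite addr_ge0// sumr_ge0.
have Ky' u : K (y' u).
  case: u => [i|[ij []]] /=; first exact: xsK'.
    exact: (h1 ij).1.
  exact: (h1 ij).2.
have [mu muE] := measure_point_masses (c := fun=> t) xs (fun=> t0).
have muE' A : measurable A -> mu A = point_masses (fun=> t) xs A by move=> _.
have [nu _ nu_uniq] : unique_solution K d mu.
  by apply: uniq_d; exists (fun=> t) => // A mA; rewrite muE fsbig_range.
have [nu0 nu0E] := charge_point_masses (fun=> t) xs.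
have [nu1 nu1E] := charge_point_masses c' y'.
have min0 : minimizer K d mu nu0.
  by apply: (point_masses_minimizer cK xsK' muE' (fun=> t0) xsK') => // A _;
    exact: nu0E.
have min1 : minimizer K d mu nu1.
  apply: (point_masses_minimizer cK xsK' muE' c'0 Ky') => [A _|q qd]; first exact: nu1E.
  rewrite big_sumType /=.
  pose G ij e := c' (inr (ij, e)) * peval q (y' (inr (ij, e))).
  rewrite [X in _ + X](eq_bigr (fun t => G t.1 t.2)); last by case=> ? [].
  rewrite -(pair_bigA _ G) /=; under [X in _ + X]eq_bigr do rewrite big_bool.
  rewrite /G /= -rel// -big_split /=; apply: eq_bigr => i _.
  by rewrite -mulrDl subrK.
(* The second minimizer has an atom of mass at least [b (i0, j0)] at [z], while the first has none
   since [z] is not one of the points. *)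
pose z := shift_coord (xs i0) j0 h.
have mz : measurable ([set z] : set T) by exact: borel_set1.
have : nu1 [set z] = nu0 [set z].
  by rewrite (nu_uniq _ min1 _ mz) (nu_uniq _ min0 _ mz).
rewrite nu0E nu1E => /(congr1 fine); rewrite !fine_point_masses.
rewrite [RHS]big1 => [|i _]; last first.
  by rewrite memNset ?mulr0// => /= xz; have := h2 i; rewrite -/z xz eqxx.
apply/eqP; rewrite gt_eqF//.
rewrite (bigD1 (inr ((i0, j0), true)))//= mem_set// mulr1.
rewrite ltr_wpDr// sumr_ge0// => u _.
by rewrite mulr_ge0// ler0n.
Qed.

End UniquenessDegreeBounds.

Lemma card_eq_range (T : pointedType) (X : set T) (k : nat) : (X #= `I_k)%card ->
  exists2 xs : 'I_k -> T, injective xs & X = range xs.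
Proof.
rewrite card_eq_sym => /card_set_bijP[f [fX f_inj f_surj]].
exists (fun i => f i) => [i j fij|].
  by apply: val_inj; apply: f_inj; rewrite ?inE /=.
apply/seteqP; split=> [x /f_surj[i ik <-]|_ [i _ <-]]; last exact: (fX _ (ltn_ord i)).
by exists (Ordinal ik).
Qed.

Theorem theorem1p2 (R : realType) (n : nat) (K X : set 'rV[R]_n)
    (cK : compact K) (fX : finite_set X) (XK : X `<=` K) :
  exists2 d : nat, is_uniqueness_degree K X d &
  [/\ forall g i : nat, is_generator_degree X g ->
        is_interpolation_degree X i -> (d <= maxn (2 * g) i)%N,
      forall k : nat, (X #= `I_k)%card ->
        ~ (exists2 H : set 'rV[R]_n, hyperplane H & X `<=` H) ->
        (d <= 2 * (k - n + 1))%N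
    & X `<=` interior K ->
        forall l : nat, is_singular_degree X l -> (l <= d)%N].
Proof.
have [k Xk] := fX; have [xs xs_inj XE] := card_eq_range Xk.
have Kxs i : K (xs i) by apply: XK; rewrite XE; exists i.
have uniq_cert d : certified xs d ->
    forall mu, positive_discrete X mu -> unique_solution K d mu.
  by rewrite XE; exact: certified_unique_recovery.
have [d [uniq_d d_min]] : exists d, is_uniqueness_degree K X d.
  exact: is_least_exists (uniq_cert _ (certified_sqdist xs_inj)).
exists d; first by split.
split=> [g i Xg Xi|k' Xk' nH|XintK l Xl].
- apply: d_min; apply: uniq_cert; rewrite XE in Xg Xi.
  exact: certified_generator_degree.
- have [ys ys_inj XE'] := card_eq_range Xk'.
  apply: d_min; rewrite XE'; apply: certified_unique_recovery => //.
    by move=> i; apply: XK; rewrite XE'; exists i.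
  by apply: certified_nondegenerate => //; rewrite -XE'.
- rewrite XE in uniq_d Xl; apply: singular_degree_le uniq_d Xl => // i.
  by apply: XintK; rewrite XE; exists i.
Qed.
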